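(* For a real number $d \ge 1$ define \[\tau(d) = \lfloor d \rfloor^{\lfloor d \rfloor + 1 - d}\,(\lfloor d \rfloor + 1)^{d - \lfloor d \rfloor}.\] Then $\tau(d) \le d$, and for every fixed real $d\ge 1$, the Asymmetric Travelling Salesman Problem (ATSP) restricted to digraphs of average outdegree at most $d$ can be solved in time $\mathcal{O}^*(\tau(d)^{n/2})$ and space $\mathcal{O}^*(\tau(d)^{n/2})$, where $n$ is the number of vertices.
   Context: ATSP: given a directed graph $G$ on $n$ vertices and an integer weight function $w: E(G)\to\mathbb{Z}$, find a Hamiltonian cycle (a directed simple cycle visiting every vertex) of minimum total weight, or report that none exists. The average outdegree of $G$ is $|E(G)|/|V(G)|$. The notation $\mathcal{O}^*(f(n))$ means $f(n)\cdot n^{\mathcal{O}(1)}$. *)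

(* Defs.v *)
From mathcomp Require Import all_boot all_order all_algebra.
From mathcomp Require Import all_classical all_reals all_analysis.

Set Implicit Arguments.
Unset Strict Implicit.
Unset Printing Implicit Defensive.

Import Order.TTheory GRing.Theory Num.Theory.
Local Open Scope ring_scope.

Definition tau (R : realType) (d : R) : R :=
  let k : R := (Num.floor d)%:~R in
  k `^ (k + 1 - d) * (k + 1) `^ (d - k).

(* A digraph on n vertices is a relation on 'I_n; self-loops are permitted and
   count as edges. *)

Definition avg_outdeg (R : realType) n (e : rel 'I_n) : R :=
  #|[set p : 'I_n * 'I_n | e p.1 p.2]|%:R / n%:R.

Definition hamiltonian_cycle n (e : rel 'I_n) (c : seq 'I_n) : Prop :=
  ucycle e c /\ forall v, v \in c.

Definition cycle_weight n (w : 'I_n -> 'I_n -> int) (c : seq 'I_n) : int :=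
  \sum_(v <- c) w v (next c v).

Definition optimal_tour n (e : rel 'I_n) (w : 'I_n -> 'I_n -> int)
    (c : seq 'I_n) : Prop :=
  hamiltonian_cycle e c /\
  forall c', hamiltonian_cycle e c' -> cycle_weight w c <= cycle_weight w c'.

(* Word RAM: a program uses finitely many of the registers (all initially 0)
   and an addressable memory of M words.  Words are signed integers of absolute
   value less than 2 ^ b; writing a larger value, or addressing a cell outside
   [0, M), is a fault.  Every instruction costs one time unit. *)

Inductive binop := Add | Sub | Mul | Div.

Inductive instr :=
  | Const of nat & int             (* r := z                                *)
  | Op of binop & nat & nat & nat  (* r := s op t                           *)
  | Get of nat & nat               (* r := cells[s]                         *)
  | Put of nat & nat               (* cells[r] := s                         *)
  | Jle of nat & nat & nat.        (* if r <= s then continue at index l    *)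

Definition program := seq instr.

Record state := State { pc : nat; regs : nat -> int; cells : nat -> int }.

(* Div is the Euclidean quotient, and division by zero yields zero. *)
Definition eval_op (o : binop) (x y : int) : int :=
  match o with
  | Add => x + y
  | Sub => x - y
  | Mul => x * y
  | Div => (x %/ y)%Z
  end.

Definition upd (f : nat -> int) (a : nat) (z : int) : nat -> int :=
  fun x => if x == a then z else f x.

Definition fits (b : nat) (z : int) : bool := (`|z| < 2 ^ b)%N.

Definition address (M : nat) (z : int) : option nat :=
  if z is Posz a then (if (a < M)%N then Some a else None) else None.

Definition write_reg (b r : nat) (z : int) (s : state) : option state :=
  if fits b z then Some (State (pc s).+1 (upd (regs s) r z) (cells s)) else None.

Definition step (M b : nat) (i : instr) (s : state) : option state :=
  match i with
  | Const r z => write_reg b r z s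
  | Op o r x y => write_reg b r (eval_op o (regs s x) (regs s y)) s
  | Get r x =>
      if address M (regs s x) is Some a then write_reg b r (cells s a) s else None
  | Put x y =>
      if address M (regs s x) is Some a
      then Some (State (pc s).+1 (regs s) (upd (cells s) a (regs s y))) else None
  | Jle x y l =>
      Some (State (if regs s x <= regs s y then l else (pc s).+1) (regs s) (cells s))
  end.

(* The final state, if P halts within t steps without a fault; halting means
   that the program counter leaves the program. *)
Fixpoint run (M b : nat) (P : program) (t : nat) (s : state) : option state :=
  if onth P (pc s) is Some i then
    if t is t'.+1 then
      if step M b i s is Some s' then run M b P t' s' else None
    else None
  else Some s.

(* Input layout: n, then for each pair (i, j) in row-major order the adjacency
   bit of (i, j) followed by its weight (0 for a non-edge). *)
Definition atsp_input n (e : rel 'I_n) (w : 'I_n -> 'I_n -> int) : seq int :=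
  n%:Z :: flatten [seq [:: (e i j : nat)%:Z; if e i j then w i j else 0]
                  | i <- enum 'I_n, j <- enum 'I_n].

Definition init_state (x : seq int) : state :=
  State 0 (fun=> 0) (fun a => nth 0 x a).

(* Register 0 is the answer flag; a tour is returned in cells 0, ..., n - 1. *)
Definition atsp_output n (e : rel 'I_n) (w : 'I_n -> 'I_n -> int)
    (s : state) : Prop :=
  (regs s 0%N = 0 /\ forall c, ~ hamiltonian_cycle e c) \/
  (regs s 0%N = 1 /\ exists2 c : seq 'I_n, optimal_tour e w c &
     [seq cells s a | a <- iota 0 n] = [seq (nat_of_ord v)%:Z | v <- c]).

Definition max_weight n (e : rel 'I_n) (w : 'I_n -> 'I_n -> int) : nat :=
  \max_(p : 'I_n * 'I_n | e p.1 p.2) `|w p.1 p.2|%N.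

(* Word length K * (n + L), where L is the number of bits of the largest
   absolute value of a weight. *)
Definition word_length (K n : nat) (e : rel 'I_n)
    (w : 'I_n -> 'I_n -> int) : nat :=
  (K * (n + up_log 2 (max_weight e w).+1))%N.

(* g is O^*(f), that is, g(n) <= f(n) * n^O(1). *)
Definition Ostar (R : realType) (f : nat -> R) (g : nat -> nat) : Prop :=
  exists C c : nat, forall n, (0 < n)%N ->
    (g n)%:R <= C%:R * f n * n%:R ^+ c.

(* One program solves all instances in the class, with words of O(n + L) bits;
   its numbers of steps and of memory cells are bounded in terms of n alone,
   independently of the weights. *)
Definition atsp_solvable (R : realType) (class : forall n, rel 'I_n -> Prop)
    (time space : nat -> R) : Prop :=
  exists (P : program) (K : nat) (T S : nat -> nat),
    [/\ Ostar time T, Ostar space S &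
        forall n (e : rel 'I_n) (w : 'I_n -> 'I_n -> int),
          (0 < n)%N -> class n e ->
          exists2 s : state,
            run (S n) (word_length K e w) P (T n)
                (init_state (atsp_input e w)) = Some s &
            atsp_output e w s].

(* Main.v *)
(* Meet in the middle on walks.  Fix the start vertex 0 and cut a Hamiltonian
   cycle at the first vertex where the product of the outdegrees passed so far
   exceeds the square root of the product Pi of all outdegrees.  Both parts then
   have outdegree product at most sqrt Pi up to a factor n, and there are at most
   r walks of given start and length whose product of the outdegrees of the
   vertices left is at most r.  So all candidate halves can be listed by a
   breadth-first search, and two halves s -> t and t -> s are paired by looking
   up the complement of a vertex set in a binary trie.  As Pi <= tau(d)^n, everything takes
   O^*(tau(d)^(n/2)) steps and cells; the program only uses Pi, never d. *)

(* The cut halves the degree product, not the length: the two halves may have very different numbers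
   of steps. The bound tau(d)^n on the product rests on the integrality of outdegrees. The line
   through the points of ln at k = floor d and k + 1 lies above ln at every positive integer, and
   its value at d is ln tau(d); plain concavity of ln would only give d^n. A word of O(n + L) bits
   holds a vertex set, and also the degree products, because the number of edges is at most d n and
   m <= 2^m. Square roots are avoided by comparing squares with a threshold. One program must serve
   all n, so iteration bounds occur only as ghosts in the analysis, never in the compiled code. *)
Require Import Defs.
From mathcomp Require Import all_boot all_order all_algebra.
From mathcomp Require Import all_classical all_reals all_analysis.
From mathcomp Require Import zify ring lra.
Import Order.TTheory GRing.Theory Num.Theory.
Set Implicit Arguments.
Unset Strict Implicit.
Unset Printing Implicit Defensive.

(** * Structured programs for the word RAM *)

(* The first argument of Until is a ghost: a bound on the number of iterations,
   ignored by the compiler but used by cost. *)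
Inductive cmd :=
  | Ins of instr
  | Seq of cmd & cmd
  | Unless of nat & nat & cmd         (* skip the body if r <= s *)
  | Until of nat & nat & nat & cmd.   (* repeat the body until r <= s *)

(** Jump targets are absolute, hence the offset [o]. The closing [Jle 0 0 o] of a loop always jumps,
    as register 0 is at most itself. *)
Fixpoint compile (o : nat) (c : cmd) : program :=
  match c with
  | Ins i => [:: i]
  | Seq c1 c2 => let p1 := compile o c1 in p1 ++ compile (o + size p1) c2
  | Unless r s c1 =>
      let p1 := compile o.+1 c1 in Jle r s (o.+1 + size p1) :: p1
  | Until _ r s c1 =>
      let p1 := compile o.+1 c1 in
      Jle r s (o + (size p1).+2) :: rcons p1 (Jle 0 0 o)
  end.

(** Forgetting the ghosts makes the commands for different [n] equal, which yields a single program
    for all instances. *)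
Fixpoint erase (c : cmd) : cmd :=
  match c with
  | Ins i => Ins i
  | Seq c1 c2 => Seq (erase c1) (erase c2)
  | Unless r s c1 => Unless r s (erase c1)
  | Until _ r s c1 => Until 0 r s (erase c1)
  end.

Lemma compile_erase o c : compile o (erase c) = compile o c.
Proof. by elim: c o => //= [c1 h1 c2 h2|r s c1 h|k r s c1 h] o; rewrite ?h1 ?h2 ?h. Qed.

(** Each iteration of a loop pays two extra steps, for its test and for the jump back; the last test
    pays one. *)
Fixpoint cost (c : cmd) : nat :=
  match c with
  | Ins _ => 1
  | Seq c1 c2 => cost c1 + cost c2
  | Unless _ _ c1 => (cost c1).+1
  | Until k _ _ c1 => k * (cost c1).+2 + 1
  end.

Section Machine.
Variables M b : nat.
Implicit Types (l : seq int) (m : nat -> int) (Q : seq int -> (nat -> int) -> Prop).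

Definition placed (P : program) (o : nat) (p : program) :=
  forall k i, onth p k = Some i -> onth P (o + k) = Some i.

Lemma placed_cat P o p1 p2 :
  placed P o (p1 ++ p2) -> placed P o p1 /\ placed P (o + size p1) p2.
Proof.
move=> h; split=> k i hk.
  apply: h; rewrite onth_cat.
  have : onth p1 k by rewrite hk.
  by rewrite onthTE => ->.
by rewrite -addnA; apply: h; rewrite onth_cat ltnNge leq_addr /= addKn.
Qed.

Lemma placed_cons P o i p :
  placed P o (i :: p) -> onth P o = Some i /\ placed P o.+1 p.
Proof.
move=> /(@placed_cat _ _ [:: i] p)[h1 h2]; split; last by move: h2; rewrite addn1.
by have := h1 0 i erefl; rewrite addn0.
Qed.

(** Quantifying over the time left, [t'], lets runs compose by adding their times, without asking
    that the program halts in between. *)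
Definition reaches (P : program) t (s s' : state) :=
  forall t', run M b P (t + t') s = run M b P t' s'.

Lemma reaches_trans P t1 t2 s1 s2 s3 :
  reaches P t1 s1 s2 -> reaches P t2 s2 s3 -> reaches P (t1 + t2) s1 s3.
Proof. by move=> h1 h2 t; rewrite -addnA h1 h2. Qed.

Lemma reaches_step P o f m s' i : onth P o = Some i ->
  step M b i (State o f m) = Some s' -> reaches P 1 (State o f m) s'.
Proof. by move=> h1 h2 t; rewrite add1n /= h1 h2. Qed.

Notation st o l m := (State o (nth (0 : int) l) m).

Lemma upd_nth l r z : upd (nth (0 : int) l) r z = nth 0%R (set_nth 0%R l r z).
Proof. by apply/funext => x; rewrite nth_set_nth. Qed.

(* Registers are kept as an explicit list, so that symbolic execution of
   straight-line code is mere computation. *)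
Definition wpre c (Q : seq int -> (nat -> int) -> Prop) l m :=
  forall P o, placed P o (compile o c) ->
  exists t l' m', [/\ t <= cost c,
    reaches P t (st o l m) (st (o + size (compile o c)) l' m') & Q l' m'].

Lemma wp_conseq c (Q Q' : seq int -> (nat -> int) -> Prop) l m :
  (forall l' m', Q l' m' -> Q' l' m') -> wpre c Q l m -> wpre c Q' l m.
Proof.
move=> hQ h P o /h[t [l' [m' [h1 h2 h3]]]].
by exists t, l', m'; split => //; apply: hQ.
Qed.

Lemma wp_ins i Q l m l' m' :
  (forall o, step M b i (st o l m) = Some (st o.+1 l' m')) ->
  Q l' m' -> wpre (Ins i) Q l m.
Proof.
move=> hs hQ P o /placed_cons[hi _]; exists 1, l', m'; split=> //=.
by rewrite addn1; apply: reaches_step hi _; rewrite hs.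
Qed.

Lemma wp_seq c1 c2 Q l m : wpre c1 (wpre c2 Q) l m -> wpre (Seq c1 c2) Q l m.
Proof.
move=> h P o /= /placed_cat[/h[t1 [l1 [m1 [ht1 hr1 h1]]]]].
move=> /h1[t2 [l2 [m2 [ht2 hr2 hQ]]]].
exists (t1 + t2), l2, m2; split=> //; first exact: leq_add.
by rewrite size_cat addnA; apply: reaches_trans hr1 hr2.
Qed.

Lemma wp_unless r s c (Q : seq int -> (nat -> int) -> Prop) l m :
  ((nth 0 l r <= nth 0 l s)%R -> Q l m) ->
  ((nth 0 l s < nth 0 l r)%R -> wpre c Q l m) -> wpre (Unless r s c) Q l m.
Proof.
move=> h1 h2 P o /= /placed_cons[hi hp].
case: (lerP (nth 0%R l r) (nth 0%R l s)) => hrs.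
  exists 1, l, m; split=> //; last exact: h1.
  by rewrite -addSnnS; apply: reaches_step hi _; rewrite /= hrs.
have [t [l' [m' [ht hr hQ]]]] := h2 hrs P o.+1 hp.
exists t.+1, l', m'; split=> //; rewrite -addSnnS -add1n.
apply: reaches_trans hr; apply: reaches_step hi _.
by rewrite /= leNgt hrs.
Qed.

(* I k is the invariant when at most k iterations remain. *)
Lemma wp_until (I : nat -> seq int -> (nat -> int) -> Prop) k r s c
    (Q : seq int -> (nat -> int) -> Prop) l m :
  (forall k l m, I k l m -> (nth 0 l r <= nth 0 l s)%R -> Q l m) ->
  (forall k l m, I k l m -> (nth 0 l s < nth 0 l r)%R ->
     0 < k /\ wpre c (I k.-1) l m) ->
  I k l m -> wpre (Until k r s c) Q l m.
Proof.
move=> hexit hbody hI P o /= hP.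
have [hi hp] := placed_cons hP.
move: (hp); rewrite -cats1 => /placed_cat[hp1 hp2].
have [hj _] := placed_cons hp2.
elim: k l m hI => [|k IH] l m hI; case: (lerP (nth 0%R l r) (nth 0%R l s)) => hrs.
- exists 1, l, m; split=> //; last exact: (hexit 0).
  by apply: reaches_step hi _; rewrite /= hrs cats1 size_rcons.
- by have [] := hbody _ _ _ hI hrs.
- exists 1, l, m; split; [by lia| |exact: (hexit k.+1)].
  by apply: reaches_step hi _; rewrite /= hrs cats1 size_rcons.
have [_ hw] := hbody _ _ _ hI hrs.
have [t1 [l1 [m1 [ht1 hr1 h1]]]] := hw P o.+1 hp1.
have [t2 [l2 [m2 [ht2 hr2 hQ]]]] := IH _ _ h1.
exists (1 + (t1 + (1 + t2))), l2, m2; split => //; first lia.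
apply: reaches_trans (reaches_step hi _) _; first by rewrite /= leNgt hrs.
apply: reaches_trans hr1 _; apply: reaches_trans hr2.
by apply: reaches_step hj _; rewrite /= lexx.
Qed.

Lemma wp_const r z Q l m :
  fits b z -> Q (set_nth 0%R l r z) m -> wpre (Ins (Const r z)) Q l m.
Proof. by move=> hz; apply: wp_ins => o; rewrite /= /write_reg hz /= upd_nth. Qed.

Lemma wp_op o r x y z Q l m : eval_op o (nth 0%R l x) (nth 0%R l y) = z ->
  fits b z -> Q (set_nth 0%R l r z) m -> wpre (Ins (Op o r x y)) Q l m.
Proof. by move=> <- hz; apply: wp_ins => k; rewrite /= /write_reg hz /= upd_nth. Qed.

Lemma wp_add r x y (u v : nat) Q l m : nth 0%R l x = u -> nth 0%R l y = v ->
  u + v < 2 ^ b -> Q (set_nth 0%R l r (Posz (u + v))) m ->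
  wpre (Ins (Op Add r x y)) Q l m.
Proof. by move=> hx hy hb; apply: wp_op => //=; rewrite hx hy. Qed.

Lemma wp_mul r x y (u v : nat) Q l m : nth 0%R l x = u -> nth 0%R l y = v ->
  u * v < 2 ^ b -> Q (set_nth 0%R l r (Posz (u * v))) m ->
  wpre (Ins (Op Mul r x y)) Q l m.
Proof. by move=> hx hy hb; apply: wp_op => //=; rewrite hx hy. Qed.

Lemma wp_sub r x y (u v : nat) Q l m : nth 0%R l x = u -> nth 0%R l y = v ->
  v <= u -> u < 2 ^ b -> Q (set_nth 0%R l r (Posz (u - v))) m ->
  wpre (Ins (Op Defs.Sub r x y)) Q l m.
Proof.
move=> hx hy hvu hb; apply: wp_op; last by rewrite /fits absz_nat; lia.
by rewrite /= hx hy subzn.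
Qed.

Lemma wp_div r x y (u v : nat) Q l m : nth 0%R l x = u -> nth 0%R l y = v ->
  u < 2 ^ b -> Q (set_nth 0%R l r (Posz (u %/ v))) m ->
  wpre (Ins (Op Div r x y)) Q l m.
Proof.
move=> hx hy hb; apply: wp_op; last first.
  by rewrite /fits absz_nat (leq_ltn_trans (leq_div _ _)).
by rewrite /= hx hy divz_nat.
Qed.

Lemma wp_get r x (a : nat) z Q l m : nth 0%R l x = a -> a < M -> m a = z ->
  fits b z -> Q (set_nth 0%R l r z) m -> wpre (Ins (Get r x)) Q l m.
Proof.
by move=> hx ha <- hz; apply: wp_ins => o; rewrite /= hx /= ha /write_reg hz upd_nth.
Qed.

Lemma wp_put r x (a : nat) z Q l m : nth 0%R l r = a -> nth 0%R l x = z ->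
  a < M -> Q l (upd m a z) -> wpre (Ins (Put r x)) Q l m.
Proof. by move=> hr <- ha; apply: wp_ins => o; rewrite /= hr /= ha. Qed.

(** A list of zeros is the all-zero register file because [nth] defaults to zero; the length 27
    covers all registers in use. Time left over is harmless, since the program counter has left the
    program. *)
Lemma wp_run c Q m T : wpre c Q (nseq 27 0%R) m -> cost c <= T ->
  exists2 s, run M b (compile 0 c) T (State 0 (fun=> 0%R) m) = Some s &
    exists l, regs s = nth 0%R l /\ Q l (cells s).
Proof.
move=> h hT; have [|t [l [m' [ht hr hQ]]]] := h (compile 0 c) 0; first by [].
exists (st (size (compile 0 c)) l m') => //; last by exists l.
have -> : State 0 (fun=> 0%R) m = st 0 (nseq 27 (0%R : int)) m.
  by congr State; apply/funext => x; rewrite nth_nseq; case: ifP.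
rewrite -(subnKC (leq_trans ht hT)) hr add0n.
have -> : forall p t' l m, run M b p t' (st (size p) l m) = Some (st (size p) l m).
  by move=> p t' l0 m0; case: t' => [|t'] /=; rewrite onth_default.
by [].
Qed.

End Machine.

(** * Walks and meeting in the middle *)

Section BitSums.

Definition bitsum (s : seq nat) := \sum_(u <- s) 2 ^ u.

Lemma bitsum_half s : uniq s ->
  bitsum s = (0 \in s) + (bitsum [seq u.-1 | u <- s & 0 < u]).*2.
Proof.
move=> us; rewrite -(count_uniq_mem 0 us) /bitsum; elim: {us}s => [|u s IH].
  by rewrite !big_nil.
rewrite big_cons IH /=; case: u => [|u] /=; first by rewrite expn0; lia.
by rewrite big_cons expnS; lia.
Qed.

(** Halving a mask shifts the set down by one, which lowers the bit position in the induction. *)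
Lemma odd_bitsum s v : uniq s -> odd (bitsum s %/ 2 ^ v) = (v \in s).
Proof.
elim: v s => [|v IH] s us; rewrite (bitsum_half us).
  by rewrite expn0 divn1 oddD odd_double addbF; case: (0 \in s).
set s' := [seq _ | _ <- _ & _].
have us' : uniq s'.
  rewrite map_inj_in_uniq ?filter_uniq // => x y.
  by rewrite !mem_filter => /andP[hx _] /andP[hy _]; lia.
rewrite expnS divnMA -muln2 addnC divnMDl // [X in _ + X]divn_small ?addn0;
  last by case: (0 \in s).
rewrite IH //; apply/mapP/idP => [[u]|hv].
  by rewrite mem_filter => /andP[hu us0] ->; rewrite prednK.
by exists v.+1; rewrite // mem_filter.
Qed.

Lemma bitsum_iota n : bitsum (iota 0 n) = 2 ^ n - 1.
Proof.
elim: n => [|n IH]; first by rewrite /bitsum big_nil.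
rewrite -addn1 iotaD /bitsum big_cat /= -/(bitsum _) IH big_seq1 addn1 expnS add0n.
by have := expn_gt0 2 n; lia.
Qed.

Lemma bitsum_compl n s : uniq s -> all (ltn^~ n) s ->
  bitsum s + bitsum [seq u <- iota 0 n | u \notin s] = 2 ^ n - 1.
Proof.
move=> us /allP hs; rewrite -bitsum_iota /bitsum [RHS](bigID (mem s)) /= big_filter.
congr addn; rewrite -[RHS]big_filter; apply/perm_big/uniq_perm => //.
  by rewrite filter_uniq // iota_uniq.
by move=> u; rewrite mem_filter mem_iota /=; case: (boolP (u \in s)) => //= /hs /= ->.
Qed.

Lemma bitsum_le n s : uniq s -> all (ltn^~ n) s -> bitsum s <= 2 ^ n - 1.
Proof. by move=> us hs; rewrite -(bitsum_compl us hs) leq_addr. Qed.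

Lemma bitsum_inj s1 s2 : uniq s1 -> uniq s2 -> bitsum s1 = bitsum s2 -> perm_eq s1 s2.
Proof.
by move=> u1 u2 h; apply: uniq_perm => // v; rewrite -!odd_bitsum // h.
Qed.

(** The equation forces the mask of [s2] to be that of the complement of [s1], and a mask determines
    its set; so addition can test for a partition although it may carry. *)
Lemma bitsum_partition n s1 s2 :
  uniq s1 -> uniq s2 -> all (ltn^~ n) s1 ->
  bitsum s1 + bitsum s2 = 2 ^ n - 1 -> perm_eq (s1 ++ s2) (iota 0 n).
Proof.
move=> u1 u2 h1 h.
have hp : perm_eq s2 [seq u <- iota 0 n | u \notin s1].
  apply: bitsum_inj; rewrite ?filter_uniq ?iota_uniq //.
  by apply: (@addnI (bitsum s1)); rewrite h (bitsum_compl u1 h1).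
have m2 u : (u \in s2) = (u \notin s1) && (u < n).
  by rewrite (perm_mem hp) mem_filter mem_iota.
apply: uniq_perm; rewrite ?iota_uniq //.
  rewrite cat_uniq u1 u2 andbT; apply/hasPn => u; rewrite m2 => /andP[]//.
move=> u; rewrite mem_cat m2 mem_iota /=; case: (boolP (u \in s1)) => //= hu.
by have /= -> := allP h1 _ hu.
Qed.

End BitSums.

Fixpoint path_weight (T : Type) (w : T -> T -> int) u (s : seq T) : int :=
  if s is v :: s' then (w u v + path_weight w v s')%R else 0%R.

(** * Walks and the breadth-first queue *)

Section Graph.
Variables (n : nat) (E : rel nat) (w : nat -> nat -> int).
Hypothesis n_gt0 : 0 < n.

(** The cut-offs [j] here and in [deg_threshold], [extensions] and [seeds] let the loop invariants
    name partial results. *)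
Definition deg_upto j u := \sum_(v < j) nat_of_bool (E u v).
Notation deg := (deg_upto n).

(* A walk is a nonempty list of vertices in reverse order: its head is the
   current vertex, its last element the starting one.  The starting vertex may
   be entered again; entered drops only the last element of the list. *)
Fixpoint entered (x : seq nat) : seq nat :=
  if x is v :: y then if y is [::] then [::] else v :: entered y else [::].

Fixpoint walk_weight (x : seq nat) : int :=
  if x is v :: y then if y is u :: _ then (walk_weight y + w u v)%R else 0%R else 0%R.

Definition walk_mask x := bitsum (entered x).
Definition walk_degprod (x : seq nat) := \prod_(u <- x) deg u.
(* With the factor 2 n ^ 2, a half whose degree product exceeds the square root of
   the total product by at most one outdegree still counts as open. *)
Definition deg_threshold j := n * n * 2 * \prod_(v < j) deg v.
Definition is_open x := walk_degprod x * walk_degprod x < deg_threshold n.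
Fixpoint all_open x := if x is _ :: y then is_open x && all_open y else true.

(** Only the walks it extends must be open: a walk is tested when it is about to be extended, not
    when it is listed. *)
Definition good_walk x := [&& x != [::], all (ltn^~ n) x, sorted (fun v u => E u v) x,
  uniq (entered x) & all_open (behead x)].

Definition extends x v := E (head 0 x) v && (v \notin entered x).
Definition extensions j x := [seq v :: x | v <- iota 0 j & extends x v].
Definition seeds j : seq (seq nat) := [seq [:: a] | a <- iota 0 j].

(** The queue after [i] entries have been processed. Entries are never removed, so the position of a
    walk is permanent and fixes the address of its record. *)
Fixpoint bfs_queue i :=
  if i is i'.+1 then
    let L := bfs_queue i' in let x := nth [::] L i' in
    L ++ (if is_open x then extensions n x else [::])
  else seeds n.

Lemma entered_cons v x : x != [::] -> entered (v :: x) = v :: entered x.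
Proof. by case: x. Qed.

Lemma mem_extensions j x z : (z \in extensions j x) =
  [&& z != [::], behead z == x, head 0 z < j & extends x (head 0 z)].
Proof.
apply/mapP/idP => [[v]|].
  by rewrite mem_filter mem_iota /= => /andP[h1 h2] ->; rewrite /= eqxx h1 h2.
case: z => // v y /= /and3P[/eqP -> h1 h2].
by exists v; rewrite // mem_filter mem_iota h1 h2.
Qed.

Lemma mem_seeds j z : (z \in seeds j) = [&& z != [::], behead z == [::] & head 0 z < j].
Proof.
apply/mapP/idP => [[v]|]; first by rewrite mem_iota => h ->.
by case: z => // v y /= /andP[/eqP -> h]; exists v; rewrite // mem_iota.
Qed.

Lemma size_seeds j : size (seeds j) = j.
Proof. by rewrite size_map size_iota. Qed.

Lemma queue_size_ge i : n <= size (bfs_queue i).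
Proof.
by elim: i => [|i IH] /=; rewrite ?size_seeds // size_cat (leq_trans IH) ?leq_addr.
Qed.

Lemma good_extend x v : good_walk x -> is_open x -> extends x v -> v < n -> good_walk (v :: x).
Proof.
move=> /and5P[h1 h2 h3 h4 h5] ho /andP[he hv] hvn; apply/and5P; split; rewrite ?entered_cons //=.
- by rewrite hvn.
- by case: x h1 h2 h3 h4 h5 ho he hv => //= u y _ _ ->; rewrite andbT.
- by rewrite hv.
- by case: x h1 h2 h3 h4 h5 ho he hv => //= u y _ _ _ _ -> ->.
Qed.

(** Guards against running past the end: there [nth] returns the empty list, which [bfs_queue] could
    extend to spurious entries. *)
Definition reached i := forall j, j < i -> j < size (bfs_queue j).

Lemma reachedS i : reached i -> i < size (bfs_queue i) -> reached i.+1.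
Proof. by move=> h hi j; rewrite ltnS leq_eqVlt => /orP[/eqP->//|/h]. Qed.

Lemma reached_pred i : reached i.+1 -> reached i.
Proof. by move=> h j hj; apply: h; rewrite ltnS ltnW. Qed.

Lemma queue_good i x : reached i -> x \in bfs_queue i -> good_walk x.
Proof.
elim: i x => [|i IH] x hi /=.
  by rewrite mem_seeds; case: x => //= v [|//] /= hv; rewrite /good_walk /= hv.
have {}IH := IH _ (reached_pred hi).
rewrite mem_cat => /orP[|]; first exact: IH.
case: ifP => // ho; rewrite mem_extensions => /and4P[hx /eqP hb h1 h2].
case: x hx hb h1 h2 => // v y _ /= -> hv hext.
by apply: good_extend => //; apply/IH/mem_nth/hi.
Qed.

Lemma queue_size_mono i j : i <= j -> size (bfs_queue i) <= size (bfs_queue j).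
Proof.
move=> /subnKC <-; elim: (j - i) => [|k IH]; first by rewrite addn0.
by rewrite addnS /= size_cat (leq_trans IH) ?leq_addr.
Qed.

Lemma queue_prefix i j k : i <= j -> k < size (bfs_queue i) ->
  nth [::] (bfs_queue j) k = nth [::] (bfs_queue i) k.
Proof.
move=> /subnKC <- hk; elim: (j - i) => [|d IH]; first by rewrite addn0.
by rewrite addnS /= nth_cat (leq_trans hk (queue_size_mono (leq_addr d i))).
Qed.

Lemma queue_parent i x : reached i -> x \in bfs_queue i ->
  behead x = [::] \/ exists2 k, k < i & behead x = nth [::] (bfs_queue i) k.
Proof.
elim: i => [|i IH] hi /=; first by rewrite mem_seeds => /and3P[_ /eqP -> _]; left.
rewrite mem_cat => /orP[/(IH (reached_pred hi)) [->|[k hk ->]]|].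
- by left.
- right; exists k; first exact: ltnW.
  by rewrite nth_cat (leq_trans (hi k _)) ?queue_size_mono // ltnW.
case: ifP => // _; rewrite mem_extensions => /and4P[_ /eqP -> _ _].
by right; exists i => //; rewrite nth_cat hi.
Qed.

(** The walks added at step [i] have entry [i] as parent, while older entries are seeds or have a
    parent at a smaller index; by induction these parents differ. *)
Lemma queue_uniq i : reached i -> uniq (bfs_queue i).
Proof.
elim: i => [|i IH] hi /=.
  by rewrite map_inj_uniq ?iota_uniq // => a a' [].
have hr := reached_pred hi.
rewrite cat_uniq IH //=; apply/andP; split; last first.
  case: ifP => // _; rewrite map_inj_uniq ?filter_uniq ?iota_uniq // => a a' [] //.
case: ifP => // _; apply/hasPn => z; rewrite mem_extensions => /and4P[hz /eqP hb _ _].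
apply/negP => /(queue_parent hr)[].
  rewrite hb => h0; have : good_walk (nth [::] (bfs_queue i) i) by apply/(queue_good hr)/mem_nth/hi.
  by rewrite h0.
case=> k hk; rewrite hb => /eqP; rewrite nth_uniq ?IH //; first by move/eqP; lia.
  exact: hi.
by rewrite (leq_trans (hi k _)) ?queue_size_mono // ltnW.
Qed.

Lemma queue_sub i j x : i <= j -> x \in bfs_queue i -> x \in bfs_queue j.
Proof.
move=> hij /(nthP [::])[k hk <-]; rewrite -(queue_prefix hij hk) mem_nth //.
exact: leq_trans hk (queue_size_mono hij).
Qed.

(** By induction the parent, which is good and open, sits at some index [k]. The queue is exhausted,
    so step [k] was performed, and it appended the walk. *)
Lemma queue_complete i x : reached i -> size (bfs_queue i) <= i -> good_walk x -> x \in bfs_queue i.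
Proof.
move=> hr hi; elim: x => [|v x IH] //; rewrite /good_walk => /and5P[_ + hs hu ho] => /= /andP[hv hx].
case: (eqVneq x [::]) => [->|x0].
  by apply: (@queue_sub 0) => //; rewrite mem_seeds /= hv.
have hox : is_open x by case: (x) x0 ho => //= ? ? _ /andP[].
have gx : good_walk x.
  rewrite /good_walk x0 hx /=; move: hu; rewrite entered_cons //= => /andP[_ ->].
  by move: hs ho; case: (x) x0 => //= ? ? _ /andP[_ ->] /andP[_ ->].
have /(nthP [::])[k hk hxk] := IH gx.
apply: (@queue_sub k.+1); first exact: leq_trans hk hi.
rewrite /= mem_cat; apply/orP; right.
have hik : k <= i by exact: ltnW (leq_trans hk hi).
have hkk := hr _ (leq_trans hk hi).
rewrite -(queue_prefix hik hkk) hxk hox mem_extensions /= eqxx hv /extends.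
move: hu; rewrite entered_cons // => /andP[-> _]; rewrite andbT.
by move: hs; case: (x) x0 => //= ? ? _ /andP[].
Qed.

(** * Counting good walks *)

Lemma deg_count u : deg u = count (E u) (iota 0 n).
Proof.
rewrite -sum1_count /deg_upto -(big_mkord xpredT (fun v => nat_of_bool (E u v))).
by rewrite [RHS]big_mkcond /index_iota subn0; apply: eq_bigr => v _; case: (E u v).
Qed.

Lemma deg_gt0 u v : E u v -> v < n -> 0 < deg u.
Proof.
by move=> h hv; rewrite deg_count -has_count; apply/hasP; exists v; rewrite ?mem_iota.
Qed.

Lemma deg_le u : deg u <= n.
Proof. by rewrite deg_count (leq_trans (count_size _ _)) ?size_iota. Qed.

(** The recursion peels off the starting vertex and charges its outdegree to the budget [r]; an
    exhausted budget leaves no walk. *)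
Fixpoint walks k a r : seq (seq nat) :=
  if k is k'.+1 then
    [seq rcons x a | u <- [seq v <- iota 0 n | E a v], x <- walks k' u (r %/ deg a)]
  else if 0 < r then [:: [:: a]] else [::].

(* Splitting the budget r evenly among the deg a successors loses nothing. *)
Lemma size_walks k a r : size (walks k a r) <= r.
Proof.
elim: k a r => [|k IH] a r /=; first by case: r.
rewrite size_allpairs_dep; apply: (@leq_trans (deg a * (r %/ deg a))).
  move: (r %/ _) => d; rewrite deg_count -size_filter.
  by elim: [seq _ <- _ | _] => //= u s hs; rewrite mulSn leq_add.
by rewrite mulnC leq_trunc_div.
Qed.

Lemma mem_walks k x r : sorted (fun v u => E u v) x -> all (ltn^~ n) x ->
  size x = k.+1 -> walk_degprod (behead x) <= r -> x \in walks k (last 0 x) r.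
Proof.
elim: k x r => [|k IH] x r; first by case: x => [|v []] //=; rewrite /walk_degprod big_nil => _ _ _ ->; rewrite inE.
case/lastP: x => // y a; rewrite size_rcons last_rcons => hs ha [hy] hp.
case: y hs ha hy hp => [//|v y] hs ha hy hp.
have hE : E a (last v y) by move: hs; rewrite /= rcons_path => /andP[].
move: ha; rewrite all_rcons => /andP[han hall].
have hl : last v y < n by apply: (allP hall); rewrite mem_last.
apply/allpairsPdep; exists (last v y), (v :: y); split => //.
  by rewrite mem_filter hE mem_iota.
apply: IH => //; first by move: hs; rewrite /= rcons_path => /andP[].
(* Rounding down loses no walk: for positive q, p <= r %/ q exactly when p * q <= r. *)
rewrite leq_divRL ?(deg_gt0 hE) //.
by move: hp; rewrite /= /walk_degprod -cats1 big_cat big_seq1.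
Qed.

Lemma size_entered x : size (entered x) = (size x).-1.
Proof. by elim: x => [|v [|u y] IH] //=; rewrite -/(entered (u :: y)) IH. Qed.

Lemma entered_sub x : {subset entered x <= x}.
Proof.
elim: x => [|v x IH] // u; case: (eqVneq x [::]) => [->//|x0].
by rewrite entered_cons // !inE => /orP[->//|/IH ->]; rewrite orbT.
Qed.

Lemma good_size x : good_walk x -> size x <= n.+1.
Proof.
move=> /and5P[x0 /allP hx _ hu _].
have : size (entered x) <= size (iota 0 n).
  apply: uniq_leq_size => // u /entered_sub /hx; rewrite mem_iota //.
by rewrite size_entered size_iota; case: (x).
Qed.

(** The current vertex has not been left yet, so only the parent is charged, and the parent is
    open. *)
Lemma good_degprod x r : (forall q, q * q < deg_threshold n -> q <= r) -> 0 < r ->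
  good_walk x -> walk_degprod (behead x) <= r.
Proof.
move=> hr r0 /and5P[_ _ _ _]; case: (behead x) => [|u y] /=.
  by rewrite /walk_degprod big_nil.
by move=> /andP[/hr].
Qed.

Lemma size_flatten_le (T : Type) (ss : seq (seq T)) k :
  all (fun s => size s <= k) ss -> size (flatten ss) <= size ss * k.
Proof.
elim: ss => //= s ss IH /andP[hs /IH h]; rewrite size_cat mulSn leq_add //.
Qed.

Lemma good_count (L : seq (seq nat)) r :
  (forall q, q * q < deg_threshold n -> q <= r) -> 0 < r ->
  uniq L -> {in L, forall x, good_walk x} -> size L <= n * n.+1 * r.
Proof.
move=> hr r0 uL hL.
(* There are n starting vertices and, no vertex being entered twice, at most n steps. *)
pose W := flatten [seq walks k a r | a <- iota 0 n, k <- iota 0 n.+1].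
apply: (@leq_trans (size W)).
  apply: uniq_leq_size => // x /hL hg; have /and5P[x0 hx hs _ _] := hg.
  apply/flattenP; exists (walks (size x).-1 (last 0 x) r); last first.
    apply: mem_walks => //; last exact: good_degprod.
    by case: (x) x0.
  apply: allpairs_f; rewrite mem_iota /=; last by have := good_size hg; case: (x) x0.
  by apply: (allP hx); case: (x) x0 => //= ? ? _; rewrite mem_last.
apply: (leq_trans (@size_flatten_le _ _ r _)).
  by apply/allP => s /allpairsP[[a k] /= [_ _ ->]]; exact: size_walks.
by rewrite size_allpairs !size_iota.
Qed.

(** Walks are reversed, so the later half stands in front; [entered] drops its start, which is
    already present as the head of [x1]. *)
Definition join_walks x2 x1 := entered x2 ++ x1.

Lemma join_cons v x2 x1 : x2 != [::] -> join_walks (v :: x2) x1 = v :: join_walks x2 x1.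
Proof. by move=> h; rewrite /join_walks entered_cons. Qed.

Lemma head_join x2 x1 : x2 != [::] -> last 0 x2 = head 0 x1 ->
  head 0 (join_walks x2 x1) = head 0 x2.
Proof. by case: x2 => [|v [|u x2]]. Qed.

Lemma last_join x2 x1 : x1 != [::] -> last 0 (join_walks x2 x1) = last 0 x1.
Proof. by case: x1 => // v x1 _; rewrite /join_walks last_cat /=. Qed.

Lemma entered_join x2 x1 : x1 != [::] ->
  entered (join_walks x2 x1) = entered x2 ++ entered x1.
Proof.
move=> h1; elim: x2 => [|v x2 IH] //; case: (eqVneq x2 [::]) => [->//|h2].
rewrite join_cons // entered_cons ?IH ?entered_cons //.
by rewrite -size_eq0 size_cat addn_eq0 !size_eq0 negb_and h1 orbT.
Qed.

Lemma sorted_join x2 x1 : x2 != [::] -> last 0 x2 = head 0 x1 ->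
  sorted (fun v u => E u v) x1 -> sorted (fun v u => E u v) x2 ->
  sorted (fun v u => E u v) (join_walks x2 x1).
Proof.
move=> h2 hl hs1; elim: x2 h2 hl => [|v x2 IH] // _; case: (eqVneq x2 [::]) => [->//|h2].
have -> : last 0 (v :: x2) = last 0 x2 by case: (x2) h2.
move=> hl hs; rewrite join_cons //.
have : head 0 (join_walks x2 x1) = head 0 x2 by exact: head_join.
have : sorted (fun v u => E u v) (join_walks x2 x1).
  by apply: IH => //; exact: path_sorted hs.
case: (join_walks x2 x1) => //= u y -> hu; move: hs; case: (x2) h2 hu => //= ? ? _ -> /andP[->] //.
Qed.

Lemma weight_cons v x : x != [::] -> walk_weight (v :: x) = (walk_weight x + w (head 0 x) v)%R.
Proof. by case: x. Qed.

Lemma weight_join x2 x1 : x1 != [::] -> x2 != [::] -> last 0 x2 = head 0 x1 ->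
  walk_weight (join_walks x2 x1) = (walk_weight x1 + walk_weight x2)%R.
Proof.
move=> h1; elim: x2 => [|v x2 IH] // _; case: (eqVneq x2 [::]) => [-> _|h2].
  by rewrite /join_walks /= GRing.addr0.
have -> : last 0 (v :: x2) = last 0 x2 by case: (x2) h2.
move=> hl; rewrite join_cons // !weight_cons ?IH ?GRing.addrA ?head_join //.
by rewrite -size_eq0 size_cat addn_eq0 !size_eq0 negb_and h1 orbT.
Qed.

Lemma path_weight_rcons u s v :
  path_weight w u (rcons s v) = (path_weight w u s + w (last u s) v)%R.
Proof.
by elim: s u => [|a s IH] u /=; rewrite ?GRing.addr0 ?GRing.add0r // IH GRing.addrA.
Qed.

Lemma weight_rev u s : walk_weight (rev (u :: s)) = path_weight w u s.
Proof.
elim/last_ind: s => [|s v IH] //.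
rewrite -rcons_cons rev_rcons weight_cons; last by rewrite -size_eq0 size_rev.
by rewrite IH path_weight_rcons rev_cons; case/lastP: (s) => [|s' a] //=;
  rewrite rev_rcons last_rcons.
Qed.

Lemma entered_rev u s : entered (rev (u :: s)) = rev s.
Proof.
elim/last_ind: s => [|s v IH] //.
by rewrite -rcons_cons rev_rcons entered_cons -?size_eq0 ?size_rev // IH rev_rcons.
Qed.

Lemma sorted_rev u s : sorted (fun v u => E u v) (rev (u :: s)) = path E u s.
Proof. by rewrite rev_sorted. Qed.

(** The first half runs from 0 to the cut vertex, the second from there back to 0. A mask records
    only entered vertices, so the start 0 is counted once, on the return, and the cut vertex is not
    counted twice. *)
Definition matching x1 x2 := [&& last 0 x1 == 0, head 0 x2 == 0,
  last 0 x2 == head 0 x1 & walk_mask x1 + walk_mask x2 == 2 ^ n - 1].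

Lemma matching_tour x1 x2 : good_walk x1 -> good_walk x2 -> matching x1 x2 ->
  let s := rev (entered x2 ++ entered x1) in
  [/\ perm_eq s (iota 0 n), path E 0 s, last 0 s = 0 &
      path_weight w 0 s = (walk_weight x1 + walk_weight x2)%R].
Proof.
move=> /and5P[x10 a1 s1 u1 _] /and5P[x20 a2 s2 u2 _] /and4P[/eqP l1 /eqP h2 /eqP hl /eqP hm] s.
(* The joined walk is the tour read backwards, with its starting vertex 0 at the end. *)
have hX : join_walks x2 x1 = rev (0 :: s).
  have hl0 : last 0 (join_walks x2 x1) = 0 by rewrite last_join.
  have : size (join_walks x2 x1) != 0 by rewrite size_cat addn_eq0 !size_eq0 negb_and x10 orbT.
  rewrite /s -entered_join //; move: hl0; rewrite -[join_walks x2 x1]revK.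
  case: (rev (join_walks x2 x1)) => [|u y]; rewrite ?size_rev // rev_cons last_rcons => ->.
  by rewrite -rev_cons entered_rev revK.
have a1' : all (ltn^~ n) (entered x1) by apply/allP => u /entered_sub /(allP a1).
split.
- rewrite /s perm_rev perm_catC; exact: bitsum_partition hm.
- by rewrite -sorted_rev -hX sorted_join.
- have := head_join x20 hl; rewrite hX h2 rev_cons.
  by case/lastP: (s) => // s' v; rewrite rev_rcons last_rcons.
- by rewrite -weight_rev -hX weight_join.
Qed.

Lemma all_open_rev t : (forall i, 0 < i <= size t -> is_open (take i t)) ->
  all_open (rev t).
Proof.
elim/last_ind: t => [|t v IH] h //; rewrite rev_rcons /= IH ?andbT.
  have := h (size t).+1; rewrite size_rcons leqnn => /(_ isT).
  rewrite -(size_rcons t v) take_size /is_open.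
  by rewrite /walk_degprod -rev_rcons (perm_big _ (permEl (perm_rev _))).
move=> i /andP[i0 hi]; have := h i; rewrite i0 size_rcons ltnW // => /(_ isT).
by rewrite -cats1 takel_cat.
Qed.

Lemma path_weight_cat u s1 s2 :
  path_weight w u (s1 ++ s2) = (path_weight w u s1 + path_weight w (last u s1) s2)%R.
Proof.
by elim: s1 u => [|a s1 IH] u /=; rewrite ?GRing.add0r // IH GRing.addrA.
Qed.

Lemma head_rev (x : seq nat) : head 0 (rev x) = last 0 x.
Proof. by case/lastP: x => // x v; rewrite rev_rcons last_rcons. Qed.

Lemma last_rev (x : seq nat) : last 0 (rev x) = head 0 x.
Proof. by rewrite -head_rev revK. Qed.

(** Passes from a path in forward order to a reversed walk; [belast] appears because the final
    vertex is not left. *)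
Lemma good_rev k y : path E k y -> all (ltn^~ n) (k :: y) -> uniq y ->
  (forall i, 0 < i <= size y -> is_open (take i (belast k y))) -> good_walk (rev (k :: y)).
Proof.
move=> hp hall uy ho; apply/and5P; split.
- by rewrite -size_eq0 size_rev.
- by rewrite all_rev.
- by rewrite sorted_rev.
- by rewrite entered_rev rev_uniq.
- by rewrite lastI rev_rcons; apply: all_open_rev => i; rewrite size_belast; exact: ho.
Qed.

Lemma degprod_cat x y : walk_degprod (x ++ y) = walk_degprod x * walk_degprod y.
Proof. by rewrite /walk_degprod big_cat. Qed.

(** The completeness half of meeting in the middle: every tour is seen as a pair of listed walks of
    the same total weight. Here [pre j] is the degree product of the first [j] vertices left. *)
Lemma tour_matching s : perm_eq s (iota 0 n) -> path E 0 s -> last 0 s = 0 ->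
  exists x1 x2, [/\ good_walk x1, good_walk x2, matching x1 x2 &
    (walk_weight x1 + walk_weight x2)%R = path_weight w 0 s].
Proof.
move=> hs hpath hlast; pose t := 0 :: s; pose pre j := walk_degprod (take j t).
have ss : size s = n by rewrite (perm_size hs) size_iota.
have st : size t = n.+1 by rewrite /= ss.
have us : uniq s by rewrite (perm_uniq hs) iota_uniq.
have ms u : u \in s = (u < n) by rewrite (perm_mem hs) mem_iota.
have mt u : u \in t -> u < n by rewrite inE => /orP[/eqP ->|]; rewrite ?ms.
have hnth j : j < n -> E (nth 0 t j) (nth 0 t j.+1).
  by move=> hj; apply: (pathP 0 hpath); rewrite ss.
have hdeg j : j < n -> 0 < deg (nth 0 t j).
  by move=> hj; apply: (deg_gt0 (hnth j hj)); rewrite mt // mem_nth // st ltnS.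
have preS j : j < n -> pre j.+1 = pre j * deg (nth 0 t j).
  move=> hj; rewrite /pre (take_nth 0) ?st ?ltnS ?(ltnW hj) //.
  by rewrite -cats1 degprod_cat /walk_degprod big_seq1.
have pre0 : pre 0 = 1 by rewrite /pre take0 /walk_degprod big_nil.
have pre_gt0 j : j <= n -> 0 < pre j.
  elim: j => [|j IH] hj; first by rewrite pre0.
  by rewrite preS // muln_gt0 IH ?hdeg // ltnW.
set D := pre n.
have hbel j : j <= n -> belast 0 (take j s) = take j t.
  move=> hj; have := lastI 0 (take j s).
  rewrite -[0 :: take j s]/(take j.+1 t) (take_nth 0) ?st ?ltnS //.
  by move=> /rcons_inj[].
have hD : \prod_(v < n) deg v = D.
  rewrite -(big_mkord xpredT deg) /index_iota subn0 -(perm_big _ hs) /=.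
  (* The tour is closed, so the vertices left are the vertices entered, in another order. *)
  have hp : perm_eq s (belast 0 s).
    have e := lastI 0 s; rewrite hlast in e.
    by rewrite -(perm_cons 0) perm_sym -perm_rcons -e.
  by rewrite (perm_big _ hp) /D /pre -hbel // take_oversize ?ss.
(* The cut: the least [m] whose prefix product exceeds the square root of [D], or [n] if there is
   none. *)
have [m hm [hlow hhigh]] : exists2 m, m <= n & (forall i, i < m -> pre i * pre i <= D) /\
    (m < n -> D < pre m * pre m).
  have hex : exists m, (m == n) || (D < pre m * pre m) by exists n; rewrite eqxx.
  have hmn := ex_minnP hex; case: hmn => m hm hmin; exists m.
    by apply: hmin; rewrite eqxx.
  split=> [i hi|hmn]; last by move: hm; rewrite (ltn_eqF hmn).
  by rewrite leqNgt; apply/negP => h; have := hmin i; rewrite h orbT => /(_ isT); lia.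
have D0 : 0 < D by exact: pre_gt0.
(* Before the cut the squares are at most [D]. At the cut one more outdegree, at most n, enters, so
   the square is at most n^2 D; the factor 2 of the threshold makes the inequality strict. *)
have hopen i : i <= m -> pre i * pre i < deg_threshold n.
  rewrite /deg_threshold hD leq_eqVlt => /orP[/eqP ->|/hlow h]; last first.
    by apply: (leq_ltn_trans h); rewrite -{1}[D]mul1n ltn_pmul2r //; nia.
  case: (m) hm hlow => [|j] hj hlow'; first by rewrite pre0; nia.
  rewrite preS //; have h1 := hlow' j (ltnSn j); have h2 := deg_le (nth 0 t j).
  apply: (@leq_ltn_trans (n * n * D)); last by rewrite ltn_pmul2r //; nia.
  by rewrite mulnACA [n * n * D]mulnC leq_mul // leq_mul.
have hlm : last 0 (take m s) = nth 0 t m.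
  rewrite (last_nth 0) size_takel ?ss // /t.
  by case: (m) hm => //= j hj; rewrite nth_take.
have hdt : nth 0 t m :: drop m s = drop m t by rewrite [RHS](drop_nth 0) ?st.
have hld : last (nth 0 t m) (drop m s) = 0.
  by rewrite -hlm -last_cat cat_take_drop.
have [hp1 hp2] : path E 0 (take m s) /\ path E (nth 0 t m) (drop m s).
  by move: hpath; rewrite -{1}(cat_take_drop m s) cat_path hlm => /andP[].
exists (rev (0 :: take m s)), (rev (nth 0 t m :: drop m s)); split.
- apply: good_rev => //.
  + by apply/allP => u; rewrite inE => /orP[/eqP ->//|/mem_take]; rewrite ms.
  + exact: take_uniq.
  + rewrite size_takel ?ss // => i /andP[i0 hi].
    by rewrite hbel // /is_open take_takel // hopen.
- apply: good_rev => //.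
  + by rewrite hdt; apply/allP => u /mem_drop /mt.
  + exact: drop_uniq.
  + have -> : belast (nth 0 t m) (drop m s) = drop m (take n t).
      have := lastI (nth 0 t m) (drop m s); rewrite hdt.
      rewrite -{1}(take_size t) st (take_nth 0) ?st // drop_rcons ?size_takel ?st //.
      by move=> /rcons_inj[].
    rewrite size_drop ss => i /andP[i0 hi].
    have hmn : m < n by lia.
    have := hhigh hmn; set A := drop m (take n t).
    (* With a the degree product of a prefix of the second half, pre m * a <= D < pre m * pre m.
       Hence a <= pre m, and so a * a <= D. *)
    have : D = pre m * (walk_degprod (take i A) * walk_degprod (drop i A)).
      by rewrite -degprod_cat cat_take_drop /pre -(take_takel t hm) -degprod_cat cat_take_drop.
    rewrite /is_open /deg_threshold hD; set a := walk_degprod (take i A); set c := walk_degprod (drop i A).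
    move=> hDe hlt; have hn : D < n * n * 2 * D by rewrite -{1}[D]mul1n ltn_pmul2r //; nia.
    apply: leq_ltn_trans hn.
    have c0 : 0 < c by move: D0; rewrite hDe !muln_gt0 => /and3P[].
    have h1 : pre m * a <= D by rewrite hDe mulnA leq_pmulr.
    have h2 : a <= pre m.
      by rewrite leqNgt; apply/negP => h; have := leq_mul (leqnn (pre m)) (ltnW h); lia.
    by apply: leq_trans h1; rewrite leq_mul.
- apply/and4P; split.
  + by rewrite last_rev.
  + by rewrite head_rev /= hld.
  + by rewrite last_rev head_rev /= hlm.
  + rewrite /walk_mask !entered_rev -(bitsum_iota n) /bitsum.
    rewrite !(perm_big _ (permEl (perm_rev _))) /= -big_cat cat_take_drop.
    by rewrite (perm_big _ hs).
- by rewrite !weight_rev -hlm -path_weight_cat cat_take_drop.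
Qed.

End Graph.

(** * The program *)

(* rPI: deg_threshold; rPW: 2 ^ n, later 2 ^ n - 1; rTB: start of the trie;
   rB1, rB2, rBW: best pair of halves and its weight. *)
Notation rFLAG := 0 (only parsing).  Notation rZERO := 1 (only parsing).
Notation rONE := 2 (only parsing).   Notation rTWO := 3 (only parsing).
Notation rSIX := 4 (only parsing).   Notation rN := 5 (only parsing).
Notation rBASE := 6 (only parsing).  Notation rHP := 7 (only parsing).
Notation rPI := 8 (only parsing).    Notation rPW := 9 (only parsing).
Notation rTB := 10 (only parsing).   Notation rI := 11 (only parsing).
Notation rV := 12 (only parsing).    Notation rK := 13 (only parsing).
Notation rX := 14 (only parsing).    Notation rA := 15 (only parsing).
Notation rST := 16 (only parsing).   Notation rCUR := 17 (only parsing).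
Notation rMASK := 18 (only parsing). Notation rQ := 19 (only parsing).
Notation rWT := 20 (only parsing).   Notation rB1 := 21 (only parsing).
Notation rB2 := 22 (only parsing).   Notation rBW := 23 (only parsing).
Notation rPV := 24 (only parsing).   Notation rDV := 25 (only parsing).
Notation rNM := 26 (only parsing).

Notation "c1 ;; c2" := (Seq c1 c2) (at level 60, right associativity).
Notation ADD r x y := (Ins (Op Add r x y)).
Notation SUB r x y := (Ins (Op Defs.Sub r x y)).
Notation MUL r x y := (Ins (Op Mul r x y)).
Notation DIV r x y := (Ins (Op Div r x y)).
Notation CONST r z := (Ins (Const r (Posz z))).
Notation GET r x := (Ins (Get r x)).
Notation PUT r x := (Ins (Put r x)).

(** [rHP] is the allocation pointer; memory is claimed upwards from it and never released. *)
Definition emits (rs : seq nat) (c : cmd) : cmd :=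
  foldr (fun r c => PUT rHP r ;; ADD rHP rHP rONE ;; c) c rs.

Arguments emits : simpl never.

(** The number 2 n^2 serves twice: as initial factor of the threshold and, plus one, as the length
    of the input, where the records begin. [rK] runs through the adjacency bits, which occupy the
    odd cells. Each vertex gets the record of its one-vertex walk. *)
Definition init_cmd n : cmd :=
  CONST rONE 1 ;; CONST rTWO 2 ;; CONST rSIX 6 ;; GET rN rZERO ;;
  MUL rPI rN rN ;; MUL rPI rPI rTWO ;; ADD rBASE rPI rONE ;;
  ADD rHP rBASE rZERO ;; CONST rK 1 ;; CONST rPW 1 ;;
  Until n rN rV
   (CONST rQ 0 ;; CONST rI 0 ;;
    Until n rN rI
     (GET rX rK ;; ADD rQ rQ rX ;; ADD rK rK rTWO ;; ADD rI rI rONE) ;;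
    emits [:: rZERO; rV; rV; rZERO; rQ; rZERO]
     (MUL rPI rPI rQ ;; MUL rPW rPW rTWO ;; ADD rV rV rONE)).

Definition load_cmd : cmd :=
  ADD rA rI rONE ;; GET rST rA ;; ADD rA rA rONE ;; GET rCUR rA ;;
  ADD rA rA rONE ;; GET rMASK rA ;; ADD rA rA rONE ;; GET rQ rA ;;
  ADD rA rA rONE ;; GET rWT rA.

(** With A = mask / 2^v, the test 2 (A / 2) + 1 <= A holds exactly when A is odd, that is, when v
    was already entered. [rDV] points to the degree product in the record of the seed of v, which is
    just the outdegree of v. *)
Definition extend_cmd n : cmd :=
  CONST rV 0 ;; CONST rPV 1 ;; MUL rK rCUR rN ;; MUL rK rK rTWO ;;
  ADD rK rK rONE ;; ADD rDV rBASE rTWO ;; ADD rDV rDV rTWO ;;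
  Until n rN rV
   (GET rX rK ;;
    Unless rX rZERO
     (DIV rA rMASK rPV ;; DIV rX rA rTWO ;; MUL rX rX rTWO ;; ADD rX rX rONE ;;
      Unless rX rA
       (ADD rA rK rONE ;; GET rX rA ;; ADD rX rWT rX ;;
        GET rA rDV ;; MUL rA rA rQ ;; ADD rNM rMASK rPV ;;
        emits [:: rI; rST; rV; rNM; rA; rX] (CONST rX 0))) ;;
    ADD rV rV rONE ;; MUL rPV rPV rTWO ;; ADD rK rK rTWO ;; ADD rDV rDV rSIX).

Definition queue_cmd n N : cmd :=
  ADD rI rBASE rZERO ;;
  Until N rHP rI
   (load_cmd ;; MUL rX rQ rQ ;; Unless rPI rX (extend_cmd n) ;; ADD rI rI rSIX).

(** Reads the lowest [n] bits of [rPV], least significant first. A child address 0 means that the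
    node is missing; it is then created from two fresh cells, which are already zero. *)
Definition descend_cmd n : cmd :=
  CONST rV 0 ;;
  Until n rN rV
   (DIV rX rPV rTWO ;; MUL rA rX rTWO ;; SUB rA rPV rA ;; ADD rPV rX rZERO ;;
    ADD rA rK rA ;; GET rK rA ;;
    Unless rONE rK (PUT rA rHP ;; ADD rK rHP rZERO ;; ADD rHP rHP rTWO) ;;
    ADD rV rV rONE).

(** Stores the second halves, those ending at 0, under their starting vertex and mask; a leaf keeps
    the record of the lightest one. An empty leaf takes the new walk, which is then compared with
    itself. *)
Definition insert_cmd n N : cmd :=
  ADD rTB rHP rZERO ;; ADD rHP rHP rN ;; ADD rHP rHP rN ;; SUB rPW rPW rONE ;;
  ADD rI rBASE rZERO ;;
  Until N rTB rI
   (load_cmd ;;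
    Unless rONE rCUR
     (ADD rK rTB rST ;; ADD rK rK rST ;; ADD rPV rMASK rZERO ;; descend_cmd n ;;
      GET rX rK ;;
      Unless rONE rX (PUT rK rI ;; ADD rX rI rZERO) ;;
      ADD rA rX rSIX ;; SUB rA rA rONE ;; GET rA rA ;;
      Unless rA rWT (PUT rK rI)) ;;
    ADD rI rI rSIX).

Definition record_cmd : cmd := ADD rB1 rI rZERO ;; ADD rB2 rX rZERO ;; ADD rBW rA rZERO.

(** Treats each walk starting at 0 as a first half. Its partner starts where it ends and has the
    complementary mask, computed by subtraction from 2^n - 1. *)
Definition query_cmd n N : cmd :=
  ADD rI rBASE rZERO ;;
  Until N rTB rI
   (load_cmd ;;
    Unless rONE rST
     (ADD rK rTB rCUR ;; ADD rK rK rCUR ;; SUB rPV rPW rMASK ;; descend_cmd n ;;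
      GET rX rK ;;
      Unless rX rZERO
       (ADD rA rX rSIX ;; SUB rA rA rONE ;; GET rA rA ;; ADD rA rWT rA ;;
        Unless rONE rFLAG (CONST rFLAG 1 ;; record_cmd) ;;
        Unless rBW rA record_cmd)) ;;
    ADD rI rI rSIX).

(** The tour is written backwards, over the input, by following parent addresses from the end of the
    second half. At its start, recognised by the address 0, it continues from the record of the
    first half, whose end is the same vertex. *)
Definition output_cmd n : cmd :=
  Unless rFLAG rZERO
   (ADD rV rN rZERO ;;
    Until n rV rZERO
     (SUB rV rV rONE ;; GET rX rB2 ;; Unless rONE rX (ADD rB2 rB1 rZERO) ;;
      ADD rA rB2 rTWO ;; GET rA rA ;; PUT rV rA ;; GET rB2 rB2)).

Definition atsp_cmd n N : cmd :=
  init_cmd n ;; queue_cmd n N ;; insert_cmd n N ;; query_cmd n N ;; output_cmd n.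

Definition wr (m : nat -> int) a (s : seq int) : nat -> int :=
  fun x => if (a <= x) && (x < a + size s) then nth 0%R s (x - a) else m x.

Lemma wr_cons m a z s : wr (upd m a z) a.+1 s = wr m a (z :: s).
Proof.
apply/funext => x; rewrite /wr /upd /=; case: (ltngtP a x) => hx /=.
- by rewrite addnS addSn; case: ifP => // _; rewrite subnS; case: (x - a) (ltac:(lia) : 0 < x - a).
- by [].
- by rewrite hx subnn addnS ltnS leq_addr.
Qed.

Lemma wr_nil m a : wr m a [::] = m.
Proof. by apply/funext => x; rewrite /wr /= addn0; case: leqP. Qed.

Lemma wr_out m a s x : (x < a) || (a + size s <= x) -> wr m a s x = m x.
Proof. by rewrite /wr => h; rewrite ifN //; lia. Qed.

Lemma wr_in m a s f : f < size s -> wr m a s (a + f) = nth 0%R s f.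
Proof. by move=> h; rewrite /wr leq_addr ltn_add2l h /= addKn. Qed.

(** * Correctness of the program by symbolic execution *)

Section Run.
Variables (M b : nat).
Implicit Types (l : seq int) (m : nat -> int) (Q : seq int -> (nat -> int) -> Prop).
Notation wp := (wpre M b).

Lemma wp_emits rs c Q (l : seq int) m (hp : nat) :
  nth 0%R l rHP = hp -> nth 0%R l rONE = 1%R -> rHP < size l ->
  all (predC1 rHP) rs -> hp + size rs <= M -> M < 2 ^ b ->
  wp c Q (set_nth 0%R l rHP (Posz (hp + size rs))) (wr m hp [seq nth 0%R l r | r <- rs]) ->
  wp (emits rs c) Q l m.
Proof.
move=> + + + + + hMb; rewrite /emits; elim: rs l m hp => [|r rs IH] l m hp h1 h2 hl /=.
  rewrite addn0 wr_nil -h1 => _ _.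
  suff -> : set_nth 0%R l 7 (nth 0%R l 7) = l by [].
  apply: (@eq_from_nth _ 0%R); first by rewrite size_set_nth (maxn_idPr hl).
  by move=> i _; rewrite nth_set_nth /=; case: eqP => [->|].
move=> /andP[hr hrs] hM hQ.
apply: wp_seq; eapply wp_put; [exact: h1|reflexivity|lia|].
apply: wp_seq; eapply wp_add; [exact: h1|exact: h2|lia|].
apply: (IH _ _ (hp + 1)); rewrite ?nth_set_nth ?size_set_nth //=; try lia.
rewrite set_set_nth eqxx; have -> : hp + 1 + size rs = hp + (size rs).+1 by lia.
rewrite addn1 wr_cons.
suff -> : [seq nth 0%R (set_nth 0%R l 7 (Posz hp.+1)) r | r <- rs] =
          [seq nth 0%R l r | r <- rs] by [].
by apply/eq_in_map => r' /(allP hrs) /= /negPf h; rewrite nth_set_nth /= h.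
Qed.

(** The full register file, with the constant registers built in so that no invariant has to restate
    them. *)
Definition rg (fl hp pi pw tb i v k x a st cur mk q wt b1 b2 bw pv dv nm : int)
    (n base : nat) : seq int :=
  [:: fl; Posz 0; Posz 1; Posz 2; Posz 6; Posz n; Posz base; hp; pi; pw; tb;
      i; v; k; x; a; st; cur; mk; q; wt; b1; b2; bw; pv; dv; nm].

Variables (n : nat) (E : rel nat) (w : nat -> nat -> int) (r W : nat).
Hypothesis n_gt0 : 0 < n.
Notation threshold := (deg_threshold n E).
Notation degprod := (walk_degprod n E).
Notation good := (good_walk n E).
Notation queue := (bfs_queue n E).
Notation seeds := (seeds).
Notation weight := (walk_weight w).
Let N := n * n.+1 * r.
Let base := n * n * 2 + 1.
Hypothesis r_gt0 : 0 < r.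
Hypothesis hr : forall q, q * q < threshold n -> q <= r.
(** Six cells per walk and two per trie root; every walk causes at most two descents, one insertion
    and one query, and a descent creates at most [n] nodes of two cells. *)
Hypothesis hM : base + 6 * N + 2 * n + 4 * (n * N) + 2 <= M.
Hypothesis hMb : M + 12 < 2 ^ b.
Hypothesis hnb : 2 ^ n.+1 < 2 ^ b.
Hypothesis hqb : (n * r) * (n * r) < 2 ^ b.
Hypothesis hpb : forall j, j <= n -> threshold j < 2 ^ b.
Hypothesis hw : forall u v, absz (w u v) <= W.
Hypothesis hWb : 2 * (n * W) < 2 ^ b.

Definition input m := forall i j, i < n -> j < n ->
  m (2 * (i * n + j) + 1) = Posz (E i j) /\
  (E i j -> m (2 * (i * n + j) + 2) = w i j).

(* Memory layout: the input lies below base; from base on there are six cells per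
   listed walk, the first one holding the address of the parent walk (0 if the
   walk has a single vertex); then comes the trie, two cells per node. *)
Definition parent L (x : seq nat) : nat :=
  if behead x is [::] then 0 else base + 6 * index (behead x) L.

Definition fields L x : seq int :=
  [:: Posz (parent L x); Posz (last 0 x); Posz (head 0 x); Posz (walk_mask x);
      Posz (degprod x); weight x].

Definition records m L := forall k f, k < size L -> f < 6 ->
  m (base + 6 * k + f) = nth 0%R (fields L (nth [::] L k)) f.

Definition parent_closed (L : seq (seq nat)) :=
  forall x, x \in L -> behead x = [::] \/ behead x \in L.

(** Untouched memory is zero, so that newly allocated trie nodes need no initialisation. *)
Definition fresh (m : nat -> int) a := forall x, a <= x -> m x = 0%R.

Lemma parent_rcons L x y : behead y = [::] \/ behead y \in L ->
  parent (rcons L x) y = parent L y.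
Proof.
rewrite /parent => -[->//|h]; rewrite -cats1 index_cat h //.
Qed.

Lemma records_rcons m L x : records m L -> parent_closed L ->
  behead x = [::] \/ behead x \in L ->
  records (wr m (base + 6 * size L) (fields L x)) (rcons L x) /\ parent_closed (rcons L x).
Proof.
move=> hm hc hx; split=> [k f|y]; last first.
  rewrite !mem_rcons !inE => hy.
  have [|->] : behead y = [::] \/ behead y \in L by case/orP: hy => [/eqP -> | /hc].
    by left.
  by right; rewrite orbT.
rewrite size_rcons ltnS leq_eqVlt => /orP[/eqP -> | hk] hf; last first.
  rewrite wr_out; last by apply/orP; left; lia.
  rewrite hm // nth_rcons hk /fields parent_rcons //.
  by apply: hc; apply: mem_nth.
by rewrite wr_in // nth_rcons ltnn eqxx /fields parent_rcons.
Qed.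

Lemma records_frame m m' L : records m L ->
  (forall a, base <= a < base + 6 * size L -> m' a = m a) -> records m' L.
Proof. by move=> h hm k f hk hf; rewrite hm ?h //; lia. Qed.

Lemma input_frame m m' : input m -> (forall a, a < base -> m' a = m a) -> input m'.
Proof.
move=> h hm i j hi hj; have [h1 h2] := h i j hi hj.
have hij : i * n + j < n * n by have := leq_mul hi (leqnn n); lia.
by rewrite !hm //; lia.
Qed.

(** Ensures that the fields of a record fit into a word. The degree product may exceed [r] by the
    outdegree of the current vertex, hence the factor [n]; a walk has at most [n] edges, hence
    [n * W]. *)
Lemma good_bounds x : good x ->
  [/\ last 0 x < n, head 0 x < n, walk_mask x < 2 ^ n, degprod x <= n * r &
      absz (weight x) <= n * W].
Proof.
move=> hg; have /and5P[x0 hx hs hu ho] := hg.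
have hl u : u \in x -> u < n by move=> /(allP hx).
have hsz := good_size hg; case: x x0 hx hs hu ho hg hsz hl => // v x _ hx hs hu ho hg hsz hl.
split.
- by apply: hl; rewrite /= mem_last.
- by apply: hl; rewrite /= mem_head.
- have := @bitsum_le n _ hu; rewrite /walk_mask; have := expn_gt0 2 n.
  have -> : all (ltn^~ n) (entered (v :: x)) by apply/allP => u /entered_sub /hl.
  by move=> h1 /(_ isT); lia.
- rewrite /walk_degprod big_cons leq_mul ?deg_le //.
  exact: (good_degprod hr r_gt0 hg).
- apply: (@leq_trans (size x * W)); last by rewrite leq_mul2r; apply/orP; right; exact: hsz.
  clear hx hs hu ho hg hsz hl; elim: x v => [|u x IH] v //.
  rewrite weight_cons // [head _ _]/= [size _]/= mulSn.
  by have := hw u v; have := IH u; move: (walk_weight _ _) (w u v) (size x * W); lia.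
Qed.

Lemma base_gt : n <= base.
Proof. by rewrite /base; nia. Qed.

(* Restricted to the natural-number facts of the context, lia is much faster. *)
Ltac nlia :=
  repeat match goal with
  | H : ?T |- _ =>
      lazymatch T with
      | is_true (leq _ _) => fail
      | @eq nat _ _ => fail
      | nat => fail
      | _ => clear H
      end
  end; lia.

Ltac ins := match goal with
  | |- wpre _ _ (Seq _ _) _ _ _ => apply: wp_seq
  | _ => idtac end.
Ltac stp := cbn [set_nth].
Ltac const := ins; eapply wp_const; [rewrite /fits; cbn [absz]|stp].
Ltac add := ins; eapply wp_add; [reflexivity|reflexivity| |stp].
Ltac mul := ins; eapply wp_mul; [reflexivity|reflexivity| |stp].
Ltac dvd := ins; eapply wp_div; [reflexivity|reflexivity| |stp].
Ltac sub := ins; eapply wp_sub; [reflexivity|reflexivity| | |stp].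
Ltac get := ins; eapply wp_get; [reflexivity| | | |stp].

Lemma nn_lt i j : i < n -> j < n -> i * n + j < n * n.
Proof. by move=> hi hj; have := leq_mul hi (leqnn n); lia. Qed.



Lemma wp_load Q fl hp pi pw tb v k x a st cur mk q wt b1 b2 bw pv dv nm m L i y :
  records m L -> i < size L -> size L <= N -> good (nth [::] L i) ->
  y = nth [::] L i ->
  (forall a', Q (rg fl hp pi pw tb (Posz (base + 6 * i)) v k x a' (Posz (last 0 y))
     (Posz (head 0 y)) (Posz (walk_mask y)) (Posz (degprod y)) (weight y) b1 b2 bw pv dv nm n base) m) ->
  wp load_cmd Q (rg fl hp pi pw tb (Posz (base + 6 * i)) v k x a st cur mk q wt b1 b2 bw pv dv nm n base) m.
Proof.
move=> hm hi hL hg hy hQ; have [h1 h2 h3 h4 h5] := good_bounds hg; rewrite -hy in h1 h2 h3 h4 h5.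
have hmf f a' : f < 6 -> a' = base + 6 * i + f -> m a' = nth 0%R (fields L y) f.
  by move=> hf ->; rewrite hy; exact: hm.
have hn2 : 2 ^ n <= 2 ^ n.+1 by rewrite leq_exp2l.
have hq1 : n * r <= (n * r) * (n * r) by rewrite leq_pmulr // muln_gt0 n_gt0.
have hbn := base_gt.
rewrite /rg /load_cmd.
add; first lia.
get; [lia|apply: (hmf 1) => //; lia|rewrite /fits; cbn; lia|].
add; first lia.
get; [lia|apply: (hmf 2) => //; lia|rewrite /fits; cbn; lia|].
add; first lia.
get; [lia|apply: (hmf 3) => //; lia|rewrite /fits; cbn; lia|].
add; first lia.
get; [lia|apply: (hmf 4) => //; lia|rewrite /fits; cbn; lia|].
add; first lia.
get; [lia|apply: (hmf 5) => //; lia|rewrite /fits; cbn; lia|].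
exact: hQ.
Qed.

Lemma cons_eq (T : Type) (x y : T) s t : x = y -> s = t -> x :: s = y :: t.
Proof. by move=> -> ->. Qed.

Ltac eqrg := rewrite /rg;
  repeat (apply: cons_eq; [first [reflexivity | congr Posz; nlia | idtac]|]); try reflexivity.

Lemma seedsS j : seeds j.+1 = rcons (seeds j) [:: j].
Proof. by rewrite /seeds -addn1 iotaD map_cat cats1. Qed.

Lemma thresholdS j : threshold j.+1 = threshold j * deg_upto E n j.
Proof. by rewrite /deg_threshold big_ord_recr mulnA. Qed.

Lemma deg_uptoS j u : deg_upto E j.+1 u = deg_upto E j u + E u j.
Proof. by rewrite /deg_upto big_ord_recr. Qed.

Lemma deg_upto_le j u : deg_upto E j u <= j.
Proof.
elim: j => [|j IH]; first by rewrite /deg_upto big_ord0.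
by rewrite deg_uptoS; case: (E u j); lia.
Qed.

Lemma wp_init Q m : m 0 = n -> input m -> fresh m base ->
  (forall i v k x a st cur mk q wt b1 b2 bw pv dv nm m',
    records m' (seeds n) -> parent_closed (seeds n) -> input m' -> fresh m' (base + 6 * n) ->
    Q (rg (Posz 0) (Posz (base + 6 * n)) (Posz (threshold n)) (Posz (2 ^ n)) (Posz 0)
         i v k x a st cur mk q wt b1 b2 bw pv dv nm n base) m') ->
  wp (init_cmd n) Q (nseq 27 0%R) m.
Proof.
move=> hn hin hf hQ; have hbn := base_gt.
have hnN : n <= N by rewrite /N -mulnA leq_pmulr // muln_gt0 r_gt0.
have h1 : threshold 0 = n * n * 2 by rewrite /deg_threshold big_ord0 muln1.
have hb0 := hpb (leq0n n); rewrite h1 in hb0.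
rewrite /init_cmd; change (nseq 27 0%R) with (nseq 27 (Posz 0)); rewrite /nseq /ncons /iter.
const; first lia. const; first lia. const; first lia.
get; [lia|exact: hn|rewrite /fits; cbn [absz]; lia|].
mul; first lia. mul; first lia. add; first lia. add; first lia.
const; first lia. const; first lia.
rewrite -/base.
pose I1 k l m := exists j i x q, [/\ k = n - j, j <= n,
  l = rg (Posz 0) (Posz (base + 6 * j)) (Posz (threshold j)) (Posz (2 ^ j)) (Posz 0)
    i (Posz j) (Posz (2 * (j * n) + 1)) x (Posz 0) (Posz 0) (Posz 0) (Posz 0) q
    (Posz 0) (Posz 0) (Posz 0) (Posz 0) (Posz 0) (Posz 0) (Posz 0) n base &
  [/\ records m (seeds j), parent_closed (seeds j), input m & fresh m (base + 6 * j)]].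
apply: (wp_until (I := I1)).
- move=> k l m1 [j [i [x [q [hk hj -> [g1 g2 g3 g4]]]]]] /=.
  rewrite lez_nat => hle; have e : j = n by lia.
  by rewrite e in g1 g2 g3 g4 *; apply: hQ.
- move=> k l m1 [j [i [x [q [hk hj -> [g1 g2 g3 g4]]]]]] /=.
  rewrite ltz_nat => hlt; split; first lia.
  rewrite /rg; const; first lia. const; first lia.
  apply: wp_seq.
  pose I2 k l m := exists j' x, [/\ k = n - j', j' <= n, m = m1 &
   l = rg (Posz 0) (Posz (base + 6 * j)) (Posz (threshold j)) (Posz (2 ^ j)) (Posz 0)
    (Posz j') (Posz j) (Posz (2 * (j * n + j') + 1)) x (Posz 0) (Posz 0) (Posz 0) (Posz 0)
    (Posz (deg_upto E j' j))
    (Posz 0) (Posz 0) (Posz 0) (Posz 0) (Posz 0) (Posz 0) (Posz 0) n base].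
  apply: (wp_until (I := I2)); last first.
  + exists 0, x; split=> //; first lia.
    by eqrg; rewrite /deg_upto big_ord0.
  + move=> k2 l2 m2 [j' [x' [hk2 hj' -> ->]]] /=.
    rewrite ltz_nat => hlt'; split; first lia.
    have [hcell _] := g3 _ _ hlt hlt'; have hij := nn_lt hlt hlt'.
    have hde := deg_upto_le j' j.
    have hEb : nat_of_bool (E j j') <= 1 by case: (E j j').
    rewrite /rg; get; [lia|exact: hcell|rewrite /fits; cbn [absz]; lia|].
    add; first lia. add; first lia. add; first lia.
    exists j'.+1, (Posz (E j j')); split=> //; [lia|].
    by eqrg; rewrite deg_uptoS.
  + move=> k2 l2 m2 [j' [x' [hk2 hj' -> ->]]] /=.
    rewrite lez_nat => hle; have {hle hk2 hj'} -> : j' = n by lia.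
    have hde := deg_upto_le n j.
    have h2j : 2 ^ j.+1 <= 2 ^ n.+1 by rewrite leq_exp2l; lia.
    rewrite expnS in h2j.
    have htj := hpb hlt; rewrite thresholdS in htj.
    rewrite /rg; apply: wp_emits; [reflexivity|reflexivity|by []|by []|rewrite /=; lia|lia|].
    stp; cbn [map nth size].
    mul; first exact: htj. mul; first lia. add; first lia.
    exists j.+1; eexists; eexists; eexists; split; [lia|lia| |].
      eqrg; first by rewrite thresholdS.
      by congr Posz; rewrite expnS mulnC.
    have [|hr1 hr2] := records_rcons (x := [:: j]) g1 g2; first by left.
    have hfe : fields (seeds j) [:: j] =
      [:: Posz 0; Posz j; Posz j; Posz 0; Posz (deg_upto E n j); Posz 0].
      by rewrite /fields /parent /walk_mask /bitsum /walk_degprod /= big_nil big_seq1.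
    rewrite hfe size_seeds in hr1; rewrite seedsS; split=> //.
      apply: (input_frame g3) => a ha; rewrite wr_out //; lia.
    move=> a ha; rewrite wr_out ?g4 //=; lia.
- exists 0, (Posz 0), (Posz 0), (Posz 0); split=> //.
  + lia.
  + by eqrg; rewrite h1.
  + split=> //; by rewrite muln0 addn0.
Qed.

Lemma extensionsS j x : extensions E j.+1 x =
  if extends E x j then rcons (extensions E j x) (j :: x) else extensions E j x.
Proof.
rewrite /extensions -{1}addn1 iotaD filter_cat map_cat /=.
by case: ifP => _; rewrite ?cats0 // -cats1.
Qed.

Lemma size_extensions_le i j x : i <= j ->
  size (extensions E i x) <= size (extensions E j x).
Proof.
by move=> /subnKC <-; rewrite !size_map iotaD filter_cat size_cat leq_addr.
Qed.

Lemma queue_size i : reached n E i -> size (queue i) <= N.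
Proof.
move=> h; apply: (good_count hr) => //; first exact: queue_uniq.
by move=> x; exact: queue_good.
Qed.

Ltac unl := first [apply: wp_seq; apply: wp_unless | apply: wp_unless];
  cbn [nth]; rewrite ?lez_nat ?ltz_nat.

Lemma wp_extend Q m i v k x0 a b1 b2 bw pv dv nm :
  let x := nth [::] (queue i) i in
  reached n E i -> i < size (queue i) -> is_open n E x ->
  records m (queue i) -> parent_closed (queue i) -> input m ->
  fresh m (base + 6 * size (queue i)) ->
  (forall v k x0 a pv dv nm m',
    records m' (queue i.+1) -> parent_closed (queue i.+1) -> input m' ->
    fresh m' (base + 6 * size (queue i.+1)) ->
    Q (rg (Posz 0) (Posz (base + 6 * size (queue i.+1))) (Posz (threshold n)) (Posz (2 ^ n)) (Posz 0)
     (Posz (base + 6 * i)) v k x0 a (Posz (last 0 x)) (Posz (head 0 x)) (Posz (walk_mask x))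
     (Posz (degprod x)) (weight x) b1 b2 bw pv dv nm n base) m') ->
  wp (extend_cmd n) Q
    (rg (Posz 0) (Posz (base + 6 * size (queue i))) (Posz (threshold n)) (Posz (2 ^ n)) (Posz 0)
     (Posz (base + 6 * i)) v k x0 a (Posz (last 0 x)) (Posz (head 0 x)) (Posz (walk_mask x))
     (Posz (degprod x)) (weight x) b1 b2 bw pv dv nm n base) m.
Proof.
have hnN : n <= N by rewrite /N -mulnA leq_pmulr // muln_gt0 r_gt0.
move=> x hre hi ho hm hc hin hf hQ; have hbn := base_gt.
have xin : x \in queue i by exact: mem_nth.
have gx : good x by exact: queue_good xin.
have /and5P[xn0 _ _ ux _] := gx.
have [hlx hhx hmx hqx hwx] := good_bounds gx.
have uq := queue_uniq n_gt0 hre.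
have hqr : degprod x <= r by exact: hr.
have hszN : size (queue i.+1) <= N by apply: queue_size; exact: reachedS.
have hQS : queue i.+1 = queue i ++ extensions E n x by rewrite /= -/x ho.
have hsz j : j <= n -> size (queue i ++ extensions E j x) <= N.
  move=> hj; apply: leq_trans hszN; rewrite hQS !size_cat leq_add2l.
  exact: size_extensions_le.
have hcn : head 0 x * n + n <= n * n by rewrite -mulSnr leq_mul2r hhx orbT.
have hnnM : n * n * 2 < base by rewrite /base; lia.
rewrite /extend_cmd {1}/rg.
const; first nlia. const; first nlia. mul; first nlia. mul; first nlia.
add; first nlia. add; first nlia. add; first nlia.
pose L j := queue i ++ extensions E j x.
pose I1 k l m := exists j x0 a nm, [/\ k = n - j, j <= n,
  l = rg (Posz 0) (Posz (base + 6 * size (L j))) (Posz (threshold n)) (Posz (2 ^ n)) (Posz 0)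
     (Posz (base + 6 * i)) (Posz j) (Posz (2 * (head 0 x * n + j) + 1)) x0 a
     (Posz (last 0 x)) (Posz (head 0 x)) (Posz (walk_mask x))
     (Posz (degprod x)) (weight x) b1 b2 bw (Posz (2 ^ j)) (Posz (base + 4 + 6 * j)) nm n base &
  [/\ records m (L j), parent_closed (L j), input m & fresh m (base + 6 * size (L j))]].
apply: (wp_until (I := I1)).
- move=> k1 l m1 [j [x1 [a1 [nm1 [hk hj -> [g1 g2 g3 g4]]]]]]; cbn [nth rg].
  rewrite lez_nat => hle; have e : j = n by lia.
  by rewrite e /L -hQS in g1 g2 g3 g4 *; apply: hQ.
- move=> k1 l m1 [j [x1 [a1 [nm1 [hk hj -> [g1 g2 g3 g4]]]]]]; cbn [nth rg].
  rewrite ltz_nat => hlt; split; first nlia.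
  have [hE hWt] := g3 _ _ hhx hlt.
  have hLj := hsz _ (ltnW hlt); rewrite -/(L j) in hLj.
  have hLj1 := hsz _ hlt; rewrite -/(L j.+1) in hLj1.
  have h2j : 2 ^ j.+1 <= 2 ^ n by rewrite leq_exp2l.
  have h2n : 2 ^ n.+1 = 2 * 2 ^ n by rewrite expnS.
  have h2jj : 2 ^ j.+1 = 2 * 2 ^ j by rewrite expnS.
  have hEb : nat_of_bool (E (head 0 x) j) <= 1 by case: (E _ j).
  have hEx := extensionsS j x.
  have tailc : forall m2 x2 a2 nm2, records m2 (L j.+1) -> parent_closed (L j.+1) -> input m2 ->
      fresh m2 (base + 6 * size (L j.+1)) ->
    wp (ADD rV rV rONE ;; MUL rPV rPV rTWO ;; ADD rK rK rTWO ;; ADD rDV rDV rSIX) (I1 k1.-1)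
     (rg (Posz 0) (Posz (base + 6 * size (L j.+1))) (Posz (threshold n)) (Posz (2 ^ n)) (Posz 0)
     (Posz (base + 6 * i)) (Posz j) (Posz (2 * (head 0 x * n + j) + 1)) x2 a2
     (Posz (last 0 x)) (Posz (head 0 x)) (Posz (walk_mask x))
     (Posz (degprod x)) (weight x) b1 b2 bw (Posz (2 ^ j)) (Posz (base + 4 + 6 * j)) nm2 n base) m2.
    move=> m2 x2 a2 nm2 k1' k2 k3 k4; rewrite /rg.
    add; first nlia. mul; first nlia. add; first nlia. add; first nlia.
    exists j.+1, x2, a2, nm2; split=> //; first nlia.
    by eqrg.
  rewrite {1}/rg; get; [nlia|exact: hE|rewrite /fits; cbn [absz]; nlia|].
  unl => [hEx0|hEx1].
    have e : L j.+1 = L j by rewrite /L hEx /extends; case: (E _ j) hEx0.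
    by rewrite -e in g1 g2 g3 g4 *; apply: tailc.
  have hEE : E (head 0 x) j by case: (E _ j) hEx1.
  dvd; first nlia.
  (* The parity of this quotient [D] tells whether [j] was entered; from here on only
     [D = 2 * D2 + odd D] is needed. *)
  have := odd_bitsum j ux; rewrite -/(walk_mask x); have := leq_div (walk_mask x) (2 ^ j).
  move: (walk_mask x %/ 2 ^ j) => D hdl hod.
  dvd; first nlia.
  have := divn_eq D 2; rewrite modn2 hod; move: (D %/ 2) => D2 hd2.
  mul; first nlia. add; first nlia.
  unl => [hskip|hnew].
    have hj1 : j \in entered x by case: (j \in entered x) hd2 => //; nlia.
    have e : L j.+1 = L j by rewrite /L hEx /extends hj1 andbF.
    by rewrite -e in g1 g2 g3 g4 *; apply: tailc.
  have hj0 : j \notin entered x by case: (j \in entered x) hd2 => //=; nlia.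
  have hext : extends E x j by rewrite /extends hEE.
  have gz : good (j :: x) by exact: good_extend.
  have [_ _ hmz hqz hwz] := good_bounds gz.
  have e : L j.+1 = rcons (L j) (j :: x) by rewrite /L hEx hext rcons_cat.
  (* The seeds open the queue in the order of the vertices, so record [j] supplies the outdegree of
     [j]. *)
  have hseed : nth [::] (L j) j = [:: j].
    have hjs : j < size (seeds n) by rewrite size_seeds.
    have hjq : j < size (queue i) by apply: leq_trans (queue_size_ge _ _ _).
    rewrite nth_cat hjq (queue_prefix (leq0n i)) //.
    by rewrite (nth_map 0) ?size_iota // nth_iota.
  have hjL : j < size (L j).
    by rewrite size_cat (leq_trans (leq_trans hlt (queue_size_ge _ E i))) ?leq_addr.
  have hdj := g1 j 4 hjL isT; rewrite hseed /= /walk_degprod big_seq1 in hdj.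
  have hdle := deg_upto_le n j.
  have hsL1 : size (L j.+1) = (size (L j)).+1 by rewrite e size_rcons.
  have hw1 := hw (head 0 x) j.
  have hW1 : W <= n * W by rewrite leq_pmull.
  have hmz' : walk_mask (j :: x) = 2 ^ j + walk_mask x by rewrite /walk_mask entered_cons // /bitsum big_cons.
  have hqz' : degprod (j :: x) = deg_upto E n j * degprod x by rewrite /walk_degprod big_cons.
  have hwz' : weight (j :: x) = (weight x + w (head 0 x) j)%R by rewrite weight_cons.
  have hqzb : n * r <= (n * r) * (n * r) by rewrite leq_pmulr // muln_gt0 n_gt0.
  add; first nlia.
  get; [nlia|etransitivity; [|exact: hWt hEE]; congr m1; nlia|rewrite /fits; apply: leq_ltn_trans hw1 _; nlia|].
  ins; eapply wp_op; [cbn [nth eval_op]; symmetry; exact: hwz'|rewrite /fits; apply: leq_ltn_trans hwz _; nlia|stp].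
  get; [nlia|etransitivity; [|exact: hdj]; congr m1; nlia|rewrite /fits; cbn [absz]; nlia|].
  mul; first by rewrite -hqz'; apply: leq_ltn_trans hqz _; nlia.
  add; first nlia.
  apply: wp_emits; [reflexivity|reflexivity|by []|by []|rewrite /=; nlia|nlia|].
  stp; cbn [map nth size].
  have [|hr1 hr2] := records_rcons (x := j :: x) g1 g2.
    by right; rewrite mem_cat xin.
  have hpar : parent (L j) (j :: x) = base + 6 * i.
    rewrite -[i in RHS](index_uniq [::] hi uq) -/x.
    have <- : index x (L j) = index x (queue i) by rewrite index_cat xin.
    by rewrite /parent /=; case: (x) xn0.
  have hlst : last 0 (j :: x) = last 0 x by case: (x) xn0.
  have hfe : fields (L j) (j :: x) =
    [:: Posz (base + 6 * i); Posz (last 0 x); Posz j; Posz (walk_mask x + 2 ^ j);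
        Posz (deg_upto E n j * degprod x); weight (j :: x)].
    by rewrite /fields hpar hlst hqz' hmz' [2 ^ j + _]addnC.
  rewrite hfe -e in hr1; rewrite -e in hr2.
  const; first nlia.
  have -> : base + 6 * size (L j) + 6 = base + 6 * size (L j.+1) by nlia.
  apply: tailc => //.
    apply: (input_frame g3) => c hc'; rewrite wr_out //; nlia.
  move=> c hc'; rewrite wr_out ?g4 //=; nlia.
- exists 0, x0, a, nm; rewrite /L /extensions /= cats0; split=> //; first nlia.
  eqrg.
Qed.

Lemma wp_queue Q m i v k x0 a st cur mk q wt b1 b2 bw pv dv nm :
  records m (seeds n) -> parent_closed (seeds n) -> input m -> fresh m (base + 6 * n) ->
  (forall v k x0 a st cur mk q wt pv dv nm m' i',
    reached n E i' -> size (queue i') <= i' ->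
    records m' (queue i') -> parent_closed (queue i') ->
    fresh m' (base + 6 * size (queue i')) ->
    Q (rg (Posz 0) (Posz (base + 6 * size (queue i'))) (Posz (threshold n)) (Posz (2 ^ n)) (Posz 0)
     (Posz (base + 6 * i')) v k x0 a st cur mk q wt b1 b2 bw pv dv nm n base) m') ->
  wp (queue_cmd n N) Q
    (rg (Posz 0) (Posz (base + 6 * n)) (Posz (threshold n)) (Posz (2 ^ n)) (Posz 0)
     i v k x0 a st cur mk q wt b1 b2 bw pv dv nm n base) m.
Proof.
move=> hm hc hin hf hQ; have hbn := base_gt.
rewrite /queue_cmd /rg; add; first nlia.
(* The queue grows while it is scanned, but never beyond [N] entries, which bounds the iterations
   left. *)
pose I1 k l m := exists i v kk x0 a st cur mk q wt pv dv nm, [/\ k = N - i, reached n E i,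
  l = rg (Posz 0) (Posz (base + 6 * size (queue i))) (Posz (threshold n)) (Posz (2 ^ n)) (Posz 0)
     (Posz (base + 6 * i)) v kk x0 a st cur mk q wt b1 b2 bw pv dv nm n base &
  [/\ records m (queue i), parent_closed (queue i), input m & fresh m (base + 6 * size (queue i))]].
apply: (wp_until (I := I1)).
- move=> k1 l m1 [i1 [v1 [kk [x1 [a1 [st1 [cur1 [mk1 [q1 [wt1 [pv1 [dv1 [nm1]]]]]]]]]]]]].
  move=> [hk hre -> [g1 g2 g3 g4]]; cbn [nth rg].
  by rewrite lez_nat => hle; apply: hQ => //; lia.
- move=> k1 l m1 [i1 [v1 [kk [x1 [a1 [st1 [cur1 [mk1 [q1 [wt1 [pv1 [dv1 [nm1]]]]]]]]]]]]].
  move=> [hk hre -> [g1 g2 g3 g4]]; cbn [nth rg].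
  rewrite ltz_nat => hlt; have hi : i1 < size (queue i1) by lia.
  have hszN := queue_size hre.
  split; first nlia.
  have hre1 := reachedS hre hi; have hszN1 := queue_size hre1.
  have gx : good (nth [::] (queue i1) i1) by apply/(queue_good hre)/mem_nth.
  apply: wp_seq; eapply wp_load; [exact: g1|exact: hi|exact: hszN|exact: gx|reflexivity|move=> a2].
  set x := nth [::] _ _ in gx *.
  have [_ _ _ hq _] := good_bounds gx.
  rewrite {1}/rg; mul; first by have := leq_mul hq hq; lia.
  have tailc : forall m2 v2 k2 x2 a2 pv2 dv2 nm2, records m2 (queue i1.+1) ->
      parent_closed (queue i1.+1) -> input m2 ->
      fresh m2 (base + 6 * size (queue i1.+1)) ->
    wp (ADD rI rI rSIX) (I1 k1.-1)
     (rg (Posz 0) (Posz (base + 6 * size (queue i1.+1))) (Posz (threshold n)) (Posz (2 ^ n)) (Posz 0)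
     (Posz (base + 6 * i1)) v2 k2 x2 a2 (Posz (last 0 x)) (Posz (head 0 x)) (Posz (walk_mask x))
     (Posz (degprod x)) (weight x) b1 b2 bw pv2 dv2 nm2 n base) m2.
    move=> m2 v2 k2 x2 a3 pv2 dv2 nm2 k2' k3 k4 k5; rewrite /rg.
    add; first nlia.
    exists i1.+1; do 12 eexists; split; [lia|done| |by split].
    by eqrg.
  unl => [hcl|hop].
    have e : queue i1.+1 = queue i1.
      by rewrite /= -/x /is_open ltnNge hcl cats0.
    by rewrite -e in g1 g2 g4 *; apply: tailc.
  by eapply wp_extend; [exact: hre|exact: hi|exact: hop|exact: g1|exact: g2|exact: g3|exact: g4|move=> *; exact: tailc].
- exists 0; do 12 eexists; rewrite /= size_seeds; split; [by rewrite subn0|by []| |by []].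
  by eqrg.
Qed.

(** * The binary trie of vertex sets *)

Fixpoint bits j z : seq bool :=
  if j is j'.+1 then odd (z %/ 2 ^ j') :: bits j' z else [::].

Lemma size_bits j z : size (bits j z) = j.
Proof. by elim: j => //= j ->. Qed.

Lemma bits_odd k z1 z2 : bits k z1 = bits k z2 ->
  forall j, j < k -> odd (z1 %/ 2 ^ j) = odd (z2 %/ 2 ^ j).
Proof.
elim: k => [|k IH] //= [h /IH h'] j; rewrite ltnS leq_eqVlt => /orP[/eqP -> //|].
exact: h'.
Qed.

Lemma bits_inj k z1 z2 : z1 < 2 ^ k -> z2 < 2 ^ k -> bits k z1 = bits k z2 -> z1 = z2.
Proof.
move=> h1 h2 /bits_odd; elim: k z1 z2 h1 h2 => [|k IH] z1 z2.
  by rewrite expn0; case: z1 => //; case: z2.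
rewrite !expnS => h1 h2 h; have h0 := h 0 isT; rewrite expn0 !divn1 in h0.
have : z1 %/ 2 = z2 %/ 2.
  apply: IH; rewrite ?ltn_divLR // 1?mulnC // => j hj.
  by have := h j.+1 hj; rewrite expnS !divnMA.
by move=> e; rewrite (divn_eq z1 2) (divn_eq z2 2) !modn2 h0 e.
Qed.

(* A trie node is named by a root t < n and the bits read so far, latest first.
   Its cells hold the addresses of its children (0 if absent); at depth n the
   first cell holds the value V of the node instead. *)
Notation label := (nat * seq bool)%type.
Implicit Types (nodes : seq label) (y : label) (V : label -> int).

Definition ptr tb nodes y : nat := if y \in nodes then tb + 2 * index y nodes else 0.

(** [nodes] is in order of allocation, so the position of a node gives its address and the roots
    come first. Child cells are specified for absent children too, and [V] vanishes off the trie;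
    both make the creation of a node a local change. *)
Definition trie tb m nodes V :=
  [/\ uniq nodes,
      forall t, t < n -> t < size nodes /\ nth (0, [::]) nodes t = (t, [::]),
      forall y, y \in nodes -> forall c p, y.2 = c :: p -> (y.1, p) \in nodes,
      forall y (c : bool), y \in nodes -> size y.2 < n ->
        m (tb + 2 * index y nodes + c) = Posz (ptr tb nodes (y.1, c :: y.2)) &
      (forall y, y \in nodes -> size y.2 = n -> m (tb + 2 * index y nodes) = V y) /\
      (forall y, y \notin nodes -> V y = Posz 0)].

Lemma index_label_inj nodes y y' : y \in nodes -> index y nodes = index y' nodes -> y = y'.
Proof.
move=> hy h; have h' : y' \in nodes by rewrite -index_mem -h index_mem.
by rewrite -(nth_index (0, [::]) hy) h nth_index.
Qed.

Lemma trie_init tb m : fresh m tb ->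
  trie tb m [seq (t, [::]) | t <- iota 0 n] (fun=> Posz 0).
Proof.
move=> hf; split.
- by rewrite map_inj_uniq ?iota_uniq // => ? ? [].
- by move=> t ht; rewrite size_map size_iota ht (nth_map 0) ?size_iota // nth_iota.
- by move=> y /mapP[t _ ->].
- move=> y c _ _; rewrite hf; last by lia.
  by rewrite /ptr ifN //; apply/mapP => -[t _ []].
- by split=> // y _ _; rewrite hf //; lia.
Qed.

(** One write to the parent suffices: the cells of the new node are zero, which is right for a node
    without children as well as for a leaf, whose [V] was zero while it was missing. *)
Lemma trie_insert tb m nodes V y (c : bool) : trie tb m nodes V ->
  fresh m (tb + 2 * size nodes) -> y \in nodes -> size y.2 < n ->
  (y.1, c :: y.2) \notin nodes ->
  trie tb (upd m (tb + 2 * index y nodes + c) (Posz (tb + 2 * size nodes)))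
    (rcons nodes (y.1, c :: y.2)) V /\
  fresh (upd m (tb + 2 * index y nodes + c) (Posz (tb + 2 * size nodes)))
    (tb + 2 * size (rcons nodes (y.1, c :: y.2))).
Proof.
move=> [hu hroot hpar hcell [hleaf hV]] hf hy hys hz.
set z := (y.1, c :: y.2) in hz *; set m' := upd _ _ _.
have hiy : index y nodes < size nodes by rewrite index_mem.
have hc1 : nat_of_bool c <= 1 by case: (c).
have hix y' : y' \in nodes -> index y' (rcons nodes z) = index y' nodes.
  by move=> h; rewrite -cats1 index_cat h.
have hiz : index z (rcons nodes z) = size nodes.
  by rewrite -cats1 index_cat (negPf hz) /= eqxx addn0.
(* Nodes are two cells apart, so distinct pairs of node and bit have distinct cells. *)
have hm' y' (c' : bool) : y' \in nodes -> (y', c') <> (y, c) ->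
    m' (tb + 2 * index y' nodes + c') = m (tb + 2 * index y' nodes + c').
  move=> h' hne; rewrite /m' /upd; case: eqP => // e; case: hne.
  have hii : index y' nodes = index y nodes by case: (c) (c') e => -[] /=; lia.
  by rewrite (index_label_inj h' hii); rewrite hii in e; case: (c) (c') e => -[] //=; lia.
have hfresh a : tb + 2 * size nodes <= a -> m' a = Posz 0.
  move=> ha; rewrite /m' /upd ifN; first exact: hf.
  by apply/eqP => e; move: ha; rewrite e; lia.
split; last by move=> a; rewrite size_rcons => ha; apply: hfresh; lia.
split.
- by rewrite rcons_uniq hz.
- move=> t ht; have [h1 h2] := hroot t ht; rewrite size_rcons nth_rcons h1; split=> //.
  exact: ltnW.
- move=> y'; rewrite mem_rcons inE => /orP[/eqP -> c' p|/hpar h c' p /h] /=.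
    by move=> [_ <-]; rewrite -surjective_pairing mem_rcons inE hy orbT.
  by rewrite mem_rcons inE => ->; rewrite orbT.
- move=> y' c'; rewrite mem_rcons inE => /orP[/eqP ->|hy'] hs.
    rewrite hiz hfresh; last by lia.
    rewrite /ptr ifN // mem_rcons inE negb_or; apply/andP; split.
      by apply/eqP => -[_ /(congr1 size)] /=; lia.
    (* The trie is closed under parents: a child already present would bring its parent, the
       supposedly new node. *)
    apply: contra hz => /hpar /(_ _ _ erefl) /=.
    by [].
  rewrite hix //; case: (eqVneq (y', c') (y, c)) => [[-> ->]|/eqP hne].
    by rewrite /m' /upd eqxx /ptr mem_rcons inE eqxx hiz.
  rewrite hm' // hcell // /ptr mem_rcons inE.
  have -> : (y'.1, c' :: y'.2) == z = false.
    apply/eqP => -[h1 h2 h3]; apply: hne.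
    by rewrite h2 (surjective_pairing y') h1 h3 -surjective_pairing.
  by case: ifP => //= h; rewrite hix.
- split=> [y'|y'].
    rewrite mem_rcons inE => /orP[/eqP ->|hy'] hs.
      by rewrite hiz hfresh // hV.
    have := @hm' y' false hy'; rewrite !addn0 hix // => ->; first exact: hleaf.
    by move=> [e _]; move: hs; rewrite e; lia.
  by rewrite mem_rcons inE negb_or => /andP[_ /hV].
Qed.

Lemma trie_update tb m nodes V y v : trie tb m nodes V -> y \in nodes -> size y.2 = n ->
  trie tb (upd m (tb + 2 * index y nodes) v) nodes (fun y' => if y' == y then v else V y').
Proof.
move=> [hu hroot hpar hcell [hleaf hV]] hy hys; split=> //.
- move=> y' c hy' hs; rewrite /upd ifN; first exact: hcell.
  apply/eqP => e; have /(index_label_inj hy') e' : index y' nodes = index y nodes.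
    by case: (c) e => /=; lia.
  by move: hs; rewrite e'; lia.
- split=> [y' hy' hs|y' hy'].
    rewrite /upd; case: (eqVneq y' y) => [->|hne]; first by rewrite eqxx.
    rewrite ifN; first exact: hleaf.
    apply/eqP => e; case/eqP: hne; apply: (index_label_inj hy'); lia.
  by rewrite ifN ?hV //; apply: contraNneq hy' => ->.
Qed.

(** Serves insertions and queries alike. Missing nodes are created in both cases, which leaves [V]
    unchanged. *)
Lemma wp_descend Q fl tb (t z : nat) pi pw i v k x a st cur mk q wt b1 b2 bw pv dv nm m nodes V :
  0 < tb -> trie tb m nodes V -> fresh m (tb + 2 * size nodes) -> t < n ->
  z < 2 ^ b -> k = Posz (tb + 2 * t) -> pv = Posz z ->
  tb + 2 * (size nodes + n) + 2 <= M ->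
  (forall v x a pv m' nodes', trie tb m' nodes' V -> fresh m' (tb + 2 * size nodes') ->
     (t, bits n z) \in nodes' -> size nodes' <= size nodes + n ->
     (forall c, c < tb -> m' c = m c) ->
     Q (rg fl (Posz (tb + 2 * size nodes')) pi pw (Posz tb) i v
       (Posz (tb + 2 * index (t, bits n z) nodes')) x a st cur mk q wt b1 b2 bw pv dv nm n base) m') ->
  wp (descend_cmd n) Q
   (rg fl (Posz (tb + 2 * size nodes)) pi pw (Posz tb) i v k x a st cur mk q wt b1 b2 bw pv dv nm n base) m.
Proof.
move=> tb0 htr hf ht hz -> -> hMt hQ.
have hbn := base_gt.
have hnN : n <= N by rewrite /N -mulnA leq_pmulr // muln_gt0 r_gt0.
rewrite /descend_cmd {1}/rg; const; first nlia.
pose I1 k l m1 := exists j x a nodes1, [/\ k = n - j, j <= n,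
  l = rg fl (Posz (tb + 2 * size nodes1)) pi pw (Posz tb) i (Posz j)
    (Posz (tb + 2 * index (t, bits j z) nodes1)) x a st cur mk q wt b1 b2 bw
    (Posz (z %/ 2 ^ j)) dv nm n base &
  [/\ trie tb m1 nodes1 V, fresh m1 (tb + 2 * size nodes1), (t, bits j z) \in nodes1,
      size nodes1 <= size nodes + j & forall c, c < tb -> m1 c = m c]].
apply: (wp_until (I := I1)).
- move=> k1 l m1 [j [x1 [a1 [nodes1 [hk hj -> [g1 g2 g3 g4 g5]]]]]]; cbn [nth rg].
  rewrite lez_nat => hle; have e : j = n by nlia.
  by rewrite e in g3 g4 *; apply: hQ.
- move=> k1 l m1 [j [x1 [a1 [nodes1 [hk hj -> [g1 g2 g3 g4 g5]]]]]]; cbn [nth rg].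
  rewrite ltz_nat => hlt; split; first nlia.
  have hdz := leq_div z (2 ^ j).
  have hin : index (t, bits j z) nodes1 < size nodes1 by rewrite index_mem.
  have hd1 : z %/ 2 ^ j.+1 = z %/ 2 ^ j %/ 2 by rewrite expnSr divnMA.
  have hd2 := divn_eq (z %/ 2 ^ j) 2; rewrite modn2 -hd1 in hd2.
  have hodd1 : nat_of_bool (odd (z %/ 2 ^ j)) <= 1 by case: odd.
  have hbS : bits j.+1 z = odd (z %/ 2 ^ j) :: bits j z by [].
  have fin : forall m2 x2 a2 nodes2, trie tb m2 nodes2 V -> fresh m2 (tb + 2 * size nodes2) ->
     (t, bits j.+1 z) \in nodes2 -> size nodes2 <= size nodes + j.+1 ->
     (forall c, c < tb -> m2 c = m c) ->
    wp (ADD rV rV rONE) (I1 k1.-1)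
     (rg fl (Posz (tb + 2 * size nodes2)) pi pw (Posz tb) i (Posz j)
       (Posz (tb + 2 * index (t, bits j.+1 z) nodes2)) x2 a2 st cur mk q wt b1 b2 bw
       (Posz (z %/ 2 ^ j.+1)) dv nm n base) m2.
    move=> m2 x2 a2 nodes2 f1 f2 f3 f4 f5; rewrite /rg; add; first nlia.
    exists j.+1, x2, a2, nodes2; split=> //; first nlia.
    by eqrg.
  rewrite {1}/rg; dvd; first nlia.
  rewrite -hd1; move: (z %/ 2 ^ j.+1) (z %/ 2 ^ j) fin hd2 hdz hodd1 hbS {hd1}.
  move=> D' D fin hd2 hdz; move: (odd D) hd2 => c hd2 hodd1 hbS.
  mul; first nlia. sub; [nlia|nlia|].
  have -> : D - D' * 2 = c by nlia.
  add; first nlia. add; first nlia.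
  have [_ _ _ hcell _] := g1.
  have hcl := hcell _ c g3; rewrite /= size_bits -hbS in hcl; have {}hcl := hcl hlt.
  have hpb1 : ptr tb nodes1 (t, bits j.+1 z) <= tb + 2 * size nodes1.
    by rewrite /ptr; case: ifP => // h; rewrite leq_add2l leq_mul2l ltnW ?index_mem.
  get; [nlia|exact: hcl|rewrite /fits; cbn [absz]; nlia|].
  rewrite addn0.
  unl => [hp1|hp0].
    have hin2 : (t, bits j.+1 z) \in nodes1 by move: hp1; rewrite /ptr; case: ifP.
    rewrite /ptr hin2; apply: fin => //; nlia.
  have hin2 : (t, bits j.+1 z) \notin nodes1.
    by apply/negP => h; move: hp0; rewrite /ptr h; nlia.
  ins; eapply wp_put; [reflexivity|reflexivity|nlia|].
  add; first nlia. add; first nlia.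
  have hsj : size (t, bits j z).2 < n by rewrite /= size_bits.
  rewrite hbS in hin2; have [h1 h2] := trie_insert g1 g2 g3 hsj hin2.
  rewrite /= -hbS in h1 h2 hin2 *.
  move: h1 h2; set m2 := upd _ _ _ => h1 h2.
  rewrite addn0.
  have -> : tb + 2 * size nodes1 + 2 = tb + 2 * size (rcons nodes1 (t, bits j.+1 z)).
    by rewrite size_rcons; nlia.
  have -> : Posz (tb + 2 * size nodes1) =
      Posz (tb + 2 * index (t, bits j.+1 z) (rcons nodes1 (t, bits j.+1 z))).
    by rewrite -cats1 index_cat (negPf hin2) /= eqxx addn0.
  apply: fin; [exact: h1|exact: h2| | |].
  + by rewrite mem_rcons inE eqxx.
  + by rewrite size_rcons; nlia.
  + by move=> c' hc'; rewrite /m2 /upd ifN ?g5 //; nlia.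
- have [_ hroot _ _ _] := htr; have [hts hnt] := hroot t ht.
  have hut : uniq nodes by case: htr.
  exists 0, x, a, nodes; rewrite addn0; split=> //; first nlia.
    have e : t = index (t, bits 0 z) nodes by rewrite -hnt index_uniq.
    by rewrite expn0 divn1 /= -e.
  by split=> //; rewrite -hnt mem_nth.
Qed.

(** * Finding and writing out the lightest pair of halves *)

Section Records.
Variable L : seq (seq nat).
Hypothesis hLN : size L <= N.
Hypothesis hLg : forall i, i < size L -> good (nth [::] L i).
Notation rec i := (nth [::] L i).
Let tb := base + 6 * size L.

Definition hits x y := (head 0 x == 0) && ((last 0 x, bits n (walk_mask x)) == y).

(** Zero can mean an empty leaf because record addresses start at [base], which is positive. Ranging
    over all labels, present in the trie or not, makes a miss in a query conclusive. *)
Definition best_leaf i V := forall y,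
  (V y = Posz 0 /\ forall j, j < i -> ~~ hits (rec j) y) \/
  exists j, [/\ j < i, V y = Posz (base + 6 * j), hits (rec j) y &
    forall j', j' < i -> hits (rec j') y -> (weight (rec j) <= weight (rec j'))%R].

Lemma best_leaf_skip i V : best_leaf i V ->
  (forall y, hits (rec i) y -> exists2 j, V y = Posz (base + 6 * j) &
     (weight (rec j) <= weight (rec i))%R) -> best_leaf i.+1 V.
Proof.
move=> hV hi y; case: (hV y) => [[h0 hn]|[j [hj h1 h2 h3]]].
  left; split=> // j; rewrite ltnS leq_eqVlt => /orP[/eqP ->|/hn //].
  by apply/negP => /hi [j']; rewrite h0 /base => -[]; lia.
right; exists j; split=> //; first exact: ltnW.
move=> j'; rewrite ltnS leq_eqVlt => /orP[/eqP -> /hi [j2]|/h3 //].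
by rewrite h1 => -[e]; have -> : j2 = j by lia.
Qed.

Lemma best_leaf_set i V y : best_leaf i V -> hits (rec i) y ->
  (forall j, V y = Posz (base + 6 * j) -> (weight (rec i) <= weight (rec j))%R) ->
  best_leaf i.+1 (fun y' => if y' == y then Posz (base + 6 * i) else V y').
Proof.
move=> hV hi hlt y'; case: (eqVneq y' y) => [->|hne].
  right; exists i; split=> // j; rewrite ltnS leq_eqVlt => /orP[/eqP ->|hj hh].
    by rewrite lexx.
  case: (hV y) => [[_ /(_ j hj)]|[j1 [h1 h2 h3 h4]]]; first by rewrite hh.
  exact: le_trans (hlt _ h2) (h4 _ hj hh).
have hni : ~~ hits (rec i) y'.
  apply: contra hne => /andP[_ /eqP <-]; by move: hi => /andP[_].
case: (hV y') => [[h0 hn]|[j [h1 h2 h3 h4]]]; [left|right].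
  by split=> // j; rewrite ltnS leq_eqVlt => /orP[/eqP ->|/hn].
exists j; split=> //; first exact: ltnW.
by move=> j'; rewrite ltnS leq_eqVlt => /orP[/eqP ->|/h4 //]; rewrite (negPf hni).
Qed.

Lemma records_tb m m' : records m L -> (forall a, a < tb -> m' a = m a) -> records m' L.
Proof. by move=> h hm; apply: records_frame h _ => a /andP[_]; exact: hm. Qed.

Lemma weight_cell m j : records m L -> j < size L -> m (base + 6 * j + 6 - 1) = weight (rec j).
Proof.
move=> hm hj; have -> : base + 6 * j + 6 - 1 = base + 6 * j + 5 by lia.
exact: (hm j 5).
Qed.

Lemma wp_insert Q pi tb0 i v k x a st cur mk q wt b1 b2 bw pv dv nm m :
  records m L -> fresh m tb ->
  (forall i v k x a st cur mk q wt pv m' nodes V,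
     records m' L -> trie tb m' nodes V -> fresh m' (tb + 2 * size nodes) ->
     size nodes <= n + n * size L -> best_leaf (size L) V ->
     Q (rg (Posz 0) (Posz (tb + 2 * size nodes)) pi (Posz (2 ^ n - 1)) (Posz tb)
       i v k x a st cur mk q wt b1 b2 bw pv dv nm n base) m') ->
  wp (insert_cmd n N) Q
    (rg (Posz 0) (Posz tb) pi (Posz (2 ^ n)) tb0
       i v k x a st cur mk q wt b1 b2 bw pv dv nm n base) m.
Proof.
move=> hm hf hQ.
have hbn := base_gt; have hb0 : 0 < base by rewrite /base; lia.
have hnN : n <= N by rewrite /N -mulnA leq_pmulr // muln_gt0 r_gt0.
have h2n : 2 ^ n.+1 = 2 * 2 ^ n by rewrite expnS.
have h2n0 := expn_gt0 2 n.
have htb : tb = base + 6 * size L by [].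
have hnL : n * size L <= n * N by rewrite leq_mul2l hLN orbT.
rewrite /insert_cmd {1}/rg; add; first nlia. add; first nlia. add; first nlia.
sub; [nlia|nlia|]. add; first nlia.
rewrite !addn0.
pose I1 k l m1 := exists i v kk x a st cur mk q wt pv nodes V, [/\ k = size L - i, i <= size L,
  l = rg (Posz 0) (Posz (tb + 2 * size nodes)) pi (Posz (2 ^ n - 1)) (Posz tb)
       (Posz (base + 6 * i)) v kk x a st cur mk q wt b1 b2 bw pv dv nm n base &
  [/\ records m1 L, trie tb m1 nodes V, fresh m1 (tb + 2 * size nodes),
     size nodes <= n + n * i & best_leaf i V]].
(* The ghost [N] is split into the true number of iterations and a slack, which the invariant
   subtracts so as to count exactly [size L - i]. *)
suff : wp (Until (size L + (N - size L)) rTB rI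
   (load_cmd ;;
    Unless rONE rCUR
     (ADD rK rTB rST ;; ADD rK rK rST ;; ADD rPV rMASK rZERO ;; descend_cmd n ;;
      GET rX rK ;;
      Unless rONE rX (PUT rK rI ;; ADD rX rI rZERO) ;;
      ADD rA rX rSIX ;; SUB rA rA rONE ;; GET rA rA ;;
      Unless rA rWT (PUT rK rI)) ;;
    ADD rI rI rSIX)) Q
    (rg (Posz 0) (Posz (tb + n + n)) pi (Posz (2 ^ n - 1)) (Posz tb)
       (Posz base) v k x a st cur mk q wt b1 b2 bw pv dv nm n base) m.
  by rewrite subnKC.
apply: (wp_until (I := fun k => I1 (k - (N - size L)))).
- move=> k1 l m1 [i1 [v1 [kk [x1 [a1 [st1 [cur1 [mk1 [q1 [wt1 [pv1 [nodes [V]]]]]]]]]]]]].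
  move=> [hk hi -> [g1 g2 g3 g4 g5]]; cbn [nth rg].
  rewrite lez_nat => hle; have e : i1 = size L by nlia.
  by rewrite e in g4 g5 *; apply: hQ g1 g2 g3 g4 g5.
- move=> k1 l m1 [i1 [v1 [kk [x1 [a1 [st1 [cur1 [mk1 [q1 [wt1 [pv1 [nodes [V]]]]]]]]]]]]].
  move=> [hk hi -> [g1 g2 g3 g4 g5]]; cbn [nth rg].
  rewrite ltz_nat => hlt; have {}hlt : i1 < size L by nlia.
  split; first nlia.
  have gx := hLg hlt.
  apply: wp_seq; eapply wp_load; [exact: g1|exact: hlt|exact: hLN|exact: gx|reflexivity|move=> a2].
  have [hlx hhx hmx _ hwx] := good_bounds gx.
  set x2 := rec i1 in gx hlx hhx hmx hwx *.
  have hni : n * i1.+1 <= n * size L by rewrite leq_mul2l hlt orbT.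
  rewrite mulnS in hni.
  have fin : forall m2 v2 k2 x3 a3 pv2 nodes2 V2,
      records m2 L -> trie tb m2 nodes2 V2 -> fresh m2 (tb + 2 * size nodes2) ->
      size nodes2 <= n + n * i1.+1 -> best_leaf i1.+1 V2 ->
    wp (ADD rI rI rSIX) (I1 (k1.-1 - (N - size L)))
     (rg (Posz 0) (Posz (tb + 2 * size nodes2)) pi (Posz (2 ^ n - 1)) (Posz tb)
       (Posz (base + 6 * i1)) v2 k2 x3 a3 (Posz (last 0 x2)) (Posz (head 0 x2)) (Posz (walk_mask x2))
       (Posz (degprod x2)) (weight x2) b1 b2 bw pv2 dv nm n base) m2.
    move=> m2 v2 k2 x3 a3 pv2 nodes2 V2 f1 f2 f3 f4 f5; rewrite /rg; add; first nlia.
    exists i1.+1; do 10 eexists; exists nodes2, V2; split; [nlia|nlia| |by split].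
    by eqrg.
  rewrite {1}/rg; unl => [hcur|hcur].
    apply: (fin _ _ _ _ _ _ _ V) => //; first by rewrite mulnS; nlia.
    apply: best_leaf_skip g5 _ => y /andP[/eqP h]; rewrite -/x2 in h.
    by rewrite h in hcur.
  have h0 : head 0 x2 = 0 by nlia.
  add; first nlia. add; first nlia. add; first nlia.
  apply: wp_seq; eapply wp_descend with (z := walk_mask x2); [by rewrite htb; nlia|exact: g2|exact: g3|exact: hlx| | | | |].
  + by nlia.
  + by congr Posz; nlia.
  + by congr Posz; rewrite addn0.
  + by nlia.
  move=> v2 x3 a3 pv2 m2 nodes2 f1 f2 f3 f4 f5.
  set y := (last 0 x2, bits n (walk_mask x2)) in f3 *.
  have hy : hits (rec i1) y by rewrite /hits -/x2 h0 /y !eqxx.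
  have hys : size y.2 = n by rewrite size_bits.
  have hiy : index y nodes2 < size nodes2 by rewrite index_mem.
  have [_ _ _ _ [hleaf _]] := f1; have hl := hleaf _ f3 hys.
  have g1' : records m2 L by apply: records_tb g1 f5.
  have hsz2 : size nodes2 <= n + n * i1.+1 by rewrite mulnS; nlia.
  pose m3 := upd m2 (tb + 2 * index y nodes2) (Posz (base + 6 * i1)).
  pose V3 y' := if y' == y then Posz (base + 6 * i1) else V y'.
  have f1' : trie tb m3 nodes2 V3 by apply: trie_update.
  have f2' : fresh m3 (tb + 2 * size nodes2).
    by move=> c hc; rewrite /m3 /upd ifN ?f2 //; nlia.
  have g1'' : records m3 L.
    by apply: (records_tb g1') => c hc; rewrite /m3 /upd ifN //; nlia.
  rewrite {1}/rg.
  case: (g5 y) => [[hV0 _]|[j [hj hVj hhj _]]].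
    get; [nlia|by rewrite hl hV0|by rewrite /fits expn_gt0|].
    unl => // _.
    ins; eapply wp_put; [reflexivity|reflexivity|nlia|].
    add; first nlia. add; first nlia. sub; [nlia|nlia|].
    rewrite addn0.
    get; [nlia|by apply: weight_cell|rewrite /fits; apply: leq_ltn_trans hwx _; nlia|].
    (* The walk just stored is compared with itself, so no second write occurs. *)
    unl => [_|]; last by rewrite ltxx.
    apply: (fin m3 _ _ _ _ _ nodes2 V3) => //.
    by apply: best_leaf_set => // j; rewrite hV0 => -[]; nlia.
  have hjL := ltn_trans hj hlt.
  have [_ _ _ _ hwj] := good_bounds (hLg hjL).
  get; [nlia|by rewrite hl hVj|rewrite /fits; cbn [absz]; nlia|].
  unl => [_|]; last by nlia.
  add; first nlia. sub; [nlia|nlia|].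
  get; [nlia|by apply: weight_cell|rewrite /fits; apply: leq_ltn_trans hwj _; nlia|].
  unl => [hle|hlt'].
    apply: (fin m2 _ _ _ _ _ nodes2 V) => //.
    apply: best_leaf_skip g5 _ => y' /andP[_ /eqP <-]; exists j => //.
  ins; eapply wp_put; [reflexivity|reflexivity|nlia|].
  apply: (fin m3 _ _ _ _ _ nodes2 V3) => //.
  apply: best_leaf_set => // j'; rewrite hVj => -[e].
  have -> : j' = j by nlia.
  exact: ltW.
- exists 0; do 10 eexists; exists [seq (t, [::]) | t <- iota 0 n], (fun=> Posz 0).
  rewrite size_map size_iota; split; [nlia|by []| |].
    by eqrg.
  split=> //; [exact: trie_init|by move=> c hc; apply: hf; nlia|by nlia|].
  by move=> y; left.
Qed.

(** The pairing as the trie lookup decides it; [cand_matching] identifies it with [matching]. *)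
Definition cand x1 x2 := (last 0 x1 == 0) && hits x2 (head 0 x1, bits n (2 ^ n - 1 - walk_mask x1)).

Definition best_pair i fl b1 b2 bw :=
  (fl = Posz 0 /\ forall j1 j2, j1 < i -> j2 < size L -> ~~ cand (rec j1) (rec j2)) \/
  (fl = Posz 1 /\ exists j1 j2, [/\ j1 < i /\ j2 < size L, cand (rec j1) (rec j2),
    b1 = Posz (base + 6 * j1) /\ b2 = Posz (base + 6 * j2),
    bw = (weight (rec j1) + weight (rec j2))%R &
    forall j1' j2', j1' < i -> j2' < size L -> cand (rec j1') (rec j2') ->
      (bw <= weight (rec j1') + weight (rec j2'))%R]).

Lemma best_pair_skip i fl b1 b2 bw : best_pair i fl b1 b2 bw ->
  (forall j2, j2 < size L -> cand (rec i) (rec j2) ->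
     fl = Posz 1 /\ (bw <= weight (rec i) + weight (rec j2))%R) ->
  best_pair i.+1 fl b1 b2 bw.
Proof.
move=> [[h0 h1]|[h0 [j1 [j2 [[h1 h2] h3 h4 h5 h6]]]]] h; [left|right]; split=> //.
  move=> j1 j2; rewrite ltnS leq_eqVlt => /orP[/eqP ->|]; last exact: h1.
  by move=> /h h'; apply/negP => /h'; rewrite h0 => -[].
exists j1, j2; split=> //; first by split=> //; exact: ltnW.
move=> j1' j2'; rewrite ltnS leq_eqVlt => /orP[/eqP ->|]; last exact: h6.
by move=> /h h' /h' [].
Qed.

(** For a fixed first half all partners share one leaf, which holds the lightest, so one comparison
    covers all pairs with this first half. *)
Lemma best_pair_set i fl b1 b2 bw j : best_pair i fl b1 b2 bw ->
  j < size L -> cand (rec i) (rec j) ->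
  (forall j2, j2 < size L -> cand (rec i) (rec j2) -> (weight (rec j) <= weight (rec j2))%R) ->
  (fl = Posz 1 -> (weight (rec i) + weight (rec j) <= bw)%R) ->
  best_pair i.+1 (Posz 1) (Posz (base + 6 * i)) (Posz (base + 6 * j))
    (weight (rec i) + weight (rec j))%R.
Proof.
move=> hb hj hc hmin hle; right; split=> //; exists i, j; split=> //.
move=> j1 j2; rewrite ltnS leq_eqVlt => /orP[/eqP -> hj2 hc2|hj1 hj2 hc2].
  by rewrite lerD2l; exact: hmin.
case: hb => [[_ /(_ j1 j2 hj1 hj2)]|[h0 [k1 [k2 [_ _ _ _ h]]]]]; first by rewrite hc2.
exact: le_trans (hle h0) (h _ _ hj1 hj2 hc2).
Qed.

Lemma wp_query Q pi i v k x a st cur mk q wt b1 b2 bw pv dv nm m nodes V :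
  records m L -> trie tb m nodes V -> fresh m (tb + 2 * size nodes) ->
  size nodes <= n + n * size L -> best_leaf (size L) V ->
  (forall fl b1 b2 bw hp i v k x a st cur mk q wt pv m',
     records m' L -> best_pair (size L) fl b1 b2 bw ->
     Q (rg fl hp pi (Posz (2 ^ n - 1)) (Posz tb)
       i v k x a st cur mk q wt b1 b2 bw pv dv nm n base) m') ->
  wp (query_cmd n N) Q
    (rg (Posz 0) (Posz (tb + 2 * size nodes)) pi (Posz (2 ^ n - 1)) (Posz tb)
       i v k x a st cur mk q wt b1 b2 bw pv dv nm n base) m.
Proof.
move=> hm ht hf hsz hV hQ.
have hbn := base_gt; have hb0 : 0 < base by rewrite /base; lia.
have hnN : n <= N by rewrite /N -mulnA leq_pmulr // muln_gt0 r_gt0.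
have h2n : 2 ^ n.+1 = 2 * 2 ^ n by rewrite expnS.
have h2n0 := expn_gt0 2 n.
have htb : tb = base + 6 * size L by [].
have hnL : n * size L <= n * N by rewrite leq_mul2l hLN orbT.
rewrite /query_cmd {1}/rg; add; first nlia.
rewrite !addn0.
pose I1 k l m1 := exists fl b1 b2 bw i v kk x a st cur mk q wt pv nodes, [/\ k = size L - i, i <= size L,
  l = rg fl (Posz (tb + 2 * size nodes)) pi (Posz (2 ^ n - 1)) (Posz tb)
       (Posz (base + 6 * i)) v kk x a st cur mk q wt b1 b2 bw pv dv nm n base &
  [/\ records m1 L, trie tb m1 nodes V, fresh m1 (tb + 2 * size nodes),
     size nodes <= n + n * size L + n * i & best_pair i fl b1 b2 bw]].
set body := (X in Until N _ _ X).
suff : wp (Until (size L + (N - size L)) rTB rI body) Q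
    (rg (Posz 0) (Posz (tb + 2 * size nodes)) pi (Posz (2 ^ n - 1)) (Posz tb)
       (Posz base) v k x a st cur mk q wt b1 b2 bw pv dv nm n base) m.
  by rewrite subnKC.
apply: (wp_until (I := fun k => I1 (k - (N - size L)))).
- move=> k1 l m1 [fl [c1 [c2 [cw [i1 [v1 [kk [x1 [a1 [st1 [cur1 [mk1 [q1 [wt1 [pv1 [nodes1]]]]]]]]]]]]]]]].
  move=> [hk hi -> [g1 g2 g3 g4 g5]]; cbn [nth rg].
  rewrite lez_nat => hle; have e : i1 = size L by nlia.
  by rewrite e in g4 g5 *; apply: hQ g1 g5.
- move=> k1 l m1 [fl [c1 [c2 [cw [i1 [v1 [kk [x1 [a1 [st1 [cur1 [mk1 [q1 [wt1 [pv1 [nodes1]]]]]]]]]]]]]]]].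
  move=> [hk hi -> [g1 g2 g3 g4 g5]]; cbn [nth rg].
  rewrite ltz_nat => hlt; have {}hlt : i1 < size L by nlia.
  split; first nlia.
  have gx := hLg hlt.
  rewrite /body; apply: wp_seq.
  eapply wp_load; [exact: g1|exact: hlt|exact: hLN|exact: gx|reflexivity|move=> a2].
  have [hlx hhx hmx _ hwx] := good_bounds gx.
  set x2 := rec i1 in gx hlx hhx hmx hwx *.
  have hni : n * i1.+1 <= n * size L by rewrite leq_mul2l hlt orbT.
  rewrite mulnS in hni.
  have fin : forall fl' d1 d2 dw m2 v2 k2 x3 a3 pv2 nodes2,
      records m2 L -> trie tb m2 nodes2 V -> fresh m2 (tb + 2 * size nodes2) ->
      size nodes2 <= n + n * size L + n * i1.+1 -> best_pair i1.+1 fl' d1 d2 dw ->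
    wp (ADD rI rI rSIX) (I1 (k1.-1 - (N - size L)))
     (rg fl' (Posz (tb + 2 * size nodes2)) pi (Posz (2 ^ n - 1)) (Posz tb)
       (Posz (base + 6 * i1)) v2 k2 x3 a3 (Posz (last 0 x2)) (Posz (head 0 x2)) (Posz (walk_mask x2))
       (Posz (degprod x2)) (weight x2) d1 d2 dw pv2 dv nm n base) m2.
    move=> fl' d1 d2 dw m2 v2 k2 x3 a3 pv2 nodes2 f1 f2 f3 f4 f5; rewrite /rg; add; first nlia.
    exists fl', d1, d2, dw, i1.+1; do 10 eexists; exists nodes2; split; [nlia|nlia| |by split].
    by eqrg.
  rewrite {1}/rg; unl => [hcur|hcur].
    apply: (fin) => //; first by rewrite mulnS; nlia.
    apply: best_pair_skip g5 _ => j2 _ /andP[/eqP h]; rewrite -/x2 in h.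
    by rewrite h in hcur.
  have h0 : last 0 x2 = 0 by nlia.
  add; first nlia. add; first nlia. sub; [nlia|nlia|].
  apply: wp_seq; eapply wp_descend with (z := 2 ^ n - 1 - walk_mask x2);
    [by rewrite htb; nlia|exact: g2|exact: g3|exact: hhx| | | | |].
  + by nlia.
  + by congr Posz; nlia.
  + by [].
  + by nlia.
  move=> v2 x3 a3 pv2 m2 nodes2 f1 f2 f3 f4 f5.
  set y := (head 0 x2, bits n (2 ^ n - 1 - walk_mask x2)) in f3 *.
  have hcy x' : cand (rec i1) x' = hits x' y by rewrite /cand -/x2 h0 eqxx.
  have hys : size y.2 = n by rewrite size_bits.
  have hiy : index y nodes2 < size nodes2 by rewrite index_mem.
  have [_ _ _ _ [hleaf _]] := f1; have hl := hleaf _ f3 hys.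
  have g1' : records m2 L by apply: records_tb g1 f5.
  have hsz2 : size nodes2 <= n + n * size L + n * i1.+1 by rewrite mulnS; nlia.
  rewrite {1}/rg.
  case: (hV y) => [[hV0 hno]|[j [hj hVj hhj hmin]]].
    get; [nlia|by rewrite hl hV0|by rewrite /fits expn_gt0|].
    unl => // _.
    apply: fin => //; apply: best_pair_skip g5 _ => j2 hj2.
    by rewrite hcy (negPf (hno _ hj2)).
  have [_ _ _ _ hwj] := good_bounds (hLg hj).
  get; [nlia|by rewrite hl hVj|rewrite /fits; cbn [absz]; nlia|].
  unl => [|_]; first by nlia.
  add; first nlia. sub; [nlia|nlia|].
  get; [nlia|by apply: weight_cell|rewrite /fits; apply: leq_ltn_trans hwj _; nlia|].
  have hwb : fits b (weight x2 + weight (rec j)).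
    have habs (u z : int) : absz (u + z)%R <= absz u + absz z by clear; lia.
    rewrite /fits; apply: leq_ltn_trans (habs _ _) _.
    by apply: leq_ltn_trans (leq_add hwx hwj) _; nlia.
  ins; eapply wp_op; [reflexivity|exact: hwb|stp].
  have hset := best_pair_set g5 hj _ _ _.
  rewrite -/x2 hcy in hset; have {}hset := hset hhj.
  have hmin' : forall j2, j2 < size L -> cand (rec i1) (rec j2) ->
      (weight (rec j) <= weight (rec j2))%R.
    by move=> j2 hj2; rewrite hcy; exact: hmin.
  have {}hset := hset hmin'.
  apply: wp_seq; apply: wp_unless; cbn [nth] => hfl.
    have hfl1 : fl = Posz 1 by case: g5 hfl => [[->]|[->]].
    unl => hbw.
      apply: fin => //; apply: best_pair_skip g5 _ => j2 hj2 hc2; split=> //.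
      apply: (le_trans hbw); rewrite lerD2l; exact: hmin'.
    rewrite /record_cmd; add; first nlia. add; first nlia.
    ins; eapply wp_op with (z := (weight x2 + weight (rec j))%R); [exact: addr0|exact: hwb|stp].
    rewrite !addn0 hfl1.
    by apply: fin => //; apply: hset => _; exact: ltW.
  have hfl0 : fl = Posz 0 by case: g5 hfl => [[->]|[->]].
  const; first nlia.
  rewrite {1}/record_cmd; add; first nlia. add; first nlia.
  ins; eapply wp_op with (z := (weight x2 + weight (rec j))%R); [exact: addr0|exact: hwb|stp].
  rewrite !addn0.
  unl => [_|]; last by rewrite ltxx.
  by apply: fin => //; apply: hset; rewrite hfl0.
- exists (Posz 0), b1, b2, bw, 0; do 10 eexists; exists nodes; split; [nlia|by []| |].
    by eqrg.
  by split=> //; [nlia|left].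
Qed.

(** Both masks are below 2^n, so equal strings of [n] bits mean equal numbers. *)
Lemma cand_matching x1 x2 : good x1 -> good x2 -> cand x1 x2 = matching n x1 x2.
Proof.
move=> g1 g2; have [_ _ h1 _ _] := good_bounds g1; have [_ _ h2 _ _] := good_bounds g2.
rewrite /cand /matching /hits; congr andb; congr andb; rewrite xpair_eqE; congr andb.
apply/eqP/eqP => h; last by congr bits; lia.
by have := bits_inj h2 _ h; have := expn_gt0 2 n; lia.
Qed.

Hypothesis hLc : parent_closed L.

Definition answer l m :=
  (nth 0%R l 0 = 0%R /\ forall x1 x2, x1 \in L -> x2 \in L -> ~~ matching n x1 x2) \/
  (nth 0%R l 0 = 1%R /\ exists x1 x2, [/\ x1 \in L, x2 \in L, matching n x1 x2,
    forall x1' x2', x1' \in L -> x2' \in L -> matching n x1' x2' ->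
      (weight x1 + weight x2 <= weight x1' + weight x2')%R &
    [seq m a | a <- iota 0 n] = [seq Posz v | v <- rev (entered x2 ++ entered x1)]]).

Lemma mem_good x : x \in L -> good x.
Proof. by move=> /(nthP [::])[j hj <-]; exact: hLg. Qed.

Lemma wp_output fl hp pi pw i v kk x a st cur mk q wt b1 b2 bw pv dv nm m :
  records m L -> best_pair (size L) fl b1 b2 bw ->
  wp (output_cmd n) answer
    (rg fl hp pi pw (Posz tb) i v kk x a st cur mk q wt b1 b2 bw pv dv nm n base) m.
Proof.
move=> hm hbest; have hbn := base_gt; have hb0 : 0 < base by rewrite /base; lia.
have hnN : n <= N by rewrite /N -mulnA leq_pmulr // muln_gt0 r_gt0.
rewrite /output_cmd {1}/rg.
case: hbest => [[-> hno]|[-> [j1 [j2 [[hj1 hj2] hc [-> ->] -> hmin]]]]].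
  unl => // _; left; split=> // x1 x2 /(nthP [::])[j1 hj1 <-] /(nthP [::])[j2 hj2 <-].
  by rewrite -cand_matching ?hno //; exact: hLg.
have g1 := hLg hj1; have g2 := hLg hj2; have hcm := hc.
rewrite cand_matching // in hcm.
have [hperm _ _ _] := matching_tour w g1 g2 hcm.
have i1 : rec j1 \in L by exact: mem_nth.
have i2 : rec j2 \in L by exact: mem_nth.
set x1 := rec j1 in hc hcm hmin g1 i1 hperm *; set x2 := rec j2 in hc hcm hmin g2 i2 hperm *.
pose d := entered x2 ++ entered x1.
have sd : size d = n by rewrite -[size d]size_rev (perm_size hperm) size_iota.
unl => // _; add; first nlia; rewrite addn0.
pose at_rec (y : seq nat) c := exists2 j, j < size L & rec j = y /\ c = base + 6 * j.
(* [d] is the tour backwards. Its first n - k entries fill the cells from k on; what is left is the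
   rest of the second half followed by the first half, or, after the switch, the rest of the first
   half. *)
pose I1 k l m1 := exists x' a' c (y : seq nat), [/\ k <= n, y \in L, at_rec y c,
  l = rg (Posz 1) hp pi pw (Posz tb) i (Posz k) kk x' a' st cur mk q wt
       (Posz (base + 6 * j1)) (Posz c) (weight x1 + weight x2)%R pv dv nm n base &
  [/\ records m1 L, entered y ++ entered x1 = drop (n - k) d \/ entered y = drop (n - k) d &
    forall c', k <= c' -> c' < n -> m1 c' = Posz (nth 0 d (n.-1 - c'))]].
have hat (y : seq nat) c f : f < 6 -> y \in L -> at_rec y c -> forall m1, records m1 L ->
    m1 (c + f) = nth 0%R (fields L y) f.
  by move=> hf _ [j hj [<- ->]] m1 h; exact: h.
have hatM (y : seq nat) c : at_rec y c -> c + 6 <= base + 6 * N by move=> [j hj [_ ->]]; nlia.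
have hpar (y : seq nat) m1 c : y \in L -> at_rec y c -> records m1 L -> behead y != [::] ->
    exists c', [/\ m1 c = Posz c', at_rec (behead y) c' & 0 < c'].
  move=> hy hc1 hm1 hb; have := hat y c 0 isT hy hc1 m1 hm1; rewrite addn0 /= /parent.
  have hbL : behead y \in L by case: (hLc hy) hb => [->|].
  case: (behead y) hb hbL => // u z _ hbL ->; eexists; split; [reflexivity| |by nlia].
  by exists (index (u :: z) L); rewrite ?index_mem ?nth_index.
have hpar0 (y : seq nat) m1 c : y \in L -> at_rec y c -> records m1 L -> behead y = [::] -> m1 c = Posz 0.
  by move=> hy hc1 hm1 hb; have := hat y c 0 isT hy hc1 m1 hm1; rewrite addn0 /= /parent hb.
apply: (wp_until (I := I1)).
- move=> k l m1 [x' [a' [c [y [hk hy hc1 -> [h1 h2 h3]]]]]]; cbn [nth rg].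
  rewrite lez_nat leqn0 => /eqP e; rewrite e in h3.
  right; split=> //; exists x1, x2; split=> //.
    move=> x1' x2' /(nthP [::])[j1' hj1' <-] /(nthP [::])[j2' hj2' <-] hc2.
    by apply: hmin => //; rewrite cand_matching //; exact: hLg.
  apply: (@eq_from_nth _ 0%R); first by rewrite !size_map size_iota size_rev sd.
  rewrite size_map size_iota => p hp'; rewrite (nth_map 0) ?size_iota // nth_iota //.
  rewrite (nth_map 0) ?size_rev ?sd // nth_rev ?sd // h3 //.
  by congr (Posz (nth _ _ _)); nlia.
- move=> k l m1 [x' [a' [c [y [hk hy hc1 -> [h1 h2 h3]]]]]]; cbn [nth rg].
  rewrite ltz_nat => hk0; split=> //.
  have hcM := hatM _ _ hc1.
  have step : forall x'' c0 (y0 : seq nat), y0 \in L -> at_rec y0 c0 -> behead y0 != [::] ->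
     entered y0 ++ entered x1 = drop (n - k) d \/ entered y0 = drop (n - k) d ->
     wp (ADD rA rB2 rTWO ;; GET rA rA ;; PUT rV rA ;; GET rB2 rB2) (I1 k.-1)
      (rg (Posz 1) hp pi pw (Posz tb) i (Posz (k - 1)) kk x'' a' st cur mk q wt
       (Posz (base + 6 * j1)) (Posz c0) (weight x1 + weight x2)%R pv dv nm n base) m1.
    move=> x'' c0 y0 hy0 hc0 hb0' he.
    have hc0M := hatM _ _ hc0.
    have [_ hhy _ _ _] := good_bounds (mem_good hy0).
    rewrite /rg; add; first nlia.
    get; [nlia|exact: (hat y0 c0 2 isT hy0 hc0 m1 h1)|rewrite /fits; cbn [absz nth fields]; nlia|].
    ins; eapply wp_put; [reflexivity|reflexivity|nlia|].
    cbn [nth fields].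
    have g1m : records (upd m1 (k - 1) (Posz (head 0 y0))) L.
      by apply: (records_frame h1) => c' /andP[hc' _]; rewrite /upd ifN //; nlia.
    have [c2 [hc2 hac2 _]] := hpar y0 _ c0 hy0 hc0 g1m hb0'.
    have hc2M := hatM _ _ hac2.
    get; [nlia|exact: hc2|rewrite /fits; cbn [absz]; nlia|].
    have he' : entered y0 = head 0 y0 :: entered (behead y0).
      by case: (y0) hb0' => // u [|v1 z].
    have hnk : n - k < size d by rewrite sd; nlia.
    have hdrop : drop (n - k) d = head 0 y0 :: drop (n - k.-1) d.
      rewrite (drop_nth 0) //; have -> : n - k.-1 = (n - k).+1 by nlia.
      congr cons; move: he; rewrite he' (drop_nth 0 hnk) => -[[]|[]] //.
    exists x'', (Posz (head 0 y0)), c2, (behead y0); split=> //; first nlia.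
      by case: (hLc hy0) hb0' => [->|].
      by eqrg.
    split=> //.
      by move: he; rewrite he' hdrop => -[[]|[]]; auto.
    move=> c' hc' hc'n; rewrite /upd; case: eqP => [->|hne].
      have -> : n.-1 - (k - 1) = n - k by nlia.
      by move: hdrop; rewrite (drop_nth 0) // => -[->].
    by apply: h3 => //; clear -hne hc' hk0; lia.
  rewrite {1}/rg; sub; [nlia|nlia|].
  (* If the current walk is exhausted while k > 0 cells remain, then it is the second half, since
     otherwise nothing would be left; so the switch to [x1] is due. *)
  case: (eqVneq (behead y) [::]) => [hb|hb].
    get; [nlia|exact: hpar0 hb|by rewrite /fits expn_gt0|].
    unl => // _.
    add; first nlia; rewrite addn0.
    have hey : entered y = [::] by case: (y) hb => // u z /= ->.
    have hdn : size (drop (n - k) d) = k by rewrite size_drop sd; nlia.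
    have hx1 : entered x1 = drop (n - k) d.
      by case: h2; rewrite hey // => h; move: hdn; rewrite -h /=; nlia.
    apply: (step _ _ x1) => //; [by exists j1| |by right].
    apply/eqP => hbx; have hx0 : entered x1 = [::] by case: (x1) hbx => // u z /= ->.
    by rewrite -hx1 hx0 /= in hdn; nlia.
  have [c3 [hc3 hac3 hc30]] := hpar y m1 c hy hc1 h1 hb.
  have hc3M := hatM _ _ hac3.
  get; [nlia|exact: hc3|rewrite /fits; cbn [absz]; nlia|].
  unl => [_|]; last by nlia.
  exact: (step _ _ y).
- exists x, a, (base + 6 * j2), x2; split=> //; [by exists j2|].
  split=> //; first by left; rewrite subnn drop0.
  by move=> c' h1 h2; nlia.
Qed.


End Records.

Definition optimal_answer (l : seq int) (m : nat -> int) :=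
  (nth 0%R l 0 = 0%R /\ forall x1 x2, good x1 -> good x2 -> ~~ matching n x1 x2) \/
  (nth 0%R l 0 = 1%R /\ exists x1 x2, [/\ good x1, good x2, matching n x1 x2,
    forall x1' x2', good x1' -> good x2' -> matching n x1' x2' ->
      (weight x1 + weight x2 <= weight x1' + weight x2')%R &
    [seq m a | a <- iota 0 n] = [seq Posz v | v <- rev (entered x2 ++ entered x1)]]).

Lemma wp_atsp m : m 0 = n -> input m -> fresh m base ->
  wp (atsp_cmd n N) optimal_answer (nseq 27 0%R) m.
Proof.
move=> m0 hin hf; rewrite /atsp_cmd.
apply: wp_seq; apply: wp_init => //.
move=> i v k x a st cur mk q wt b1 b2 bw pv dv nm m1 h1 h2 h3 h4.
apply: wp_seq; apply: wp_queue => //.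
move=> {}v {}k {}x {}a {}st {}cur {}mk {}q {}wt {}pv {}dv {}nm m2 i' hre hsz g1 g2 g3.
set L := queue i' in hsz g1 g2 g3 *.
have hLN : size L <= N by exact: queue_size.
have hLg j : j < size L -> good (nth [::] L j).
  by move=> hj; apply: queue_good hre _; exact: mem_nth.
have hLc x' : x' \in L -> good x' by move=> /(nthP [::])[j hj <-]; exact: hLg.
have hLi x' : good x' -> x' \in L by exact: queue_complete.
apply: wp_seq; eapply wp_insert; [exact: hLN|exact: hLg|exact: g1|exact: g3|].
move=> {}i {}v {}k {}x {}a {}st {}cur {}mk {}q {}wt {}pv m3 nodes V f1 f2 f3 f4 f5.
apply: wp_seq; eapply wp_query; [exact: hLN|exact: hLg|exact: f1|exact: f2|exact: f3|exact: f4|exact: f5|].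
move=> fl {}b1 {}b2 {}bw hp {}i {}v {}k {}x {}a {}st {}cur {}mk {}q {}wt {}pv m4 e1 e2.
eapply wp_conseq; last by eapply wp_output; [exact: hLN|exact: hLg|exact: g2|exact: e1|exact: e2].
move=> l' m' [[h0 h]|[h0 [x1 [x2 [h5 h6 h7 h8 h9]]]]]; [left|right]; split=> //.
  by move=> x1 x2 /hLi + /hLi; exact: h.
exists x1, x2; split=> //; [exact: hLc|exact: hLc|].
by move=> x1' x2' /hLi + /hLi; exact: h8.
Qed.

End Run.

(** * Estimates for tau *)

Section Tau.
Local Open Scope ring_scope.
Variables (R : realType) (d : R).
Hypothesis hd : 1 <= d.

Let k : R := (Num.floor d)%:~R.

Lemma floor_nat : exists2 m : nat, (0 < m)%N & k = m%:R.
Proof.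
have h1 : (0 < Num.floor d)%R by rewrite floor_gt0.
exists `|Num.floor d|%N; first by rewrite absz_gt0 gt_eqF.
by rewrite /k natr_absz ger0_norm // ltW.
Qed.

Lemma k_ge1 : 1 <= k.
Proof. by have [m hm ->] := floor_nat; rewrite ler1n. Qed.

Lemma k_le : k <= d. Proof. exact: floor_le. Qed.

Lemma k_gt : d < k + 1. Proof. by have := floorD1_gt d; rewrite intrD. Qed.

Let rho := (k + 1) / k.

Lemma rho_ge1 : 1 <= rho.
Proof. by have := k_ge1 => h; rewrite /rho ler_pdivlMr; lra. Qed.

(** In this form ln tau(d) is the line through the points of ln at k and k + 1, with slope ln
    rho. *)
Lemma tauE : tau d = k * rho `^ (d - k).
Proof.
have hk := k_ge1; have hk0 : k != 0 by apply: lt0r_neq0; lra.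
rewrite /tau -/k; have -> : k + 1 - d = 1 + - (d - k) by ring.
rewrite [k `^ (1 + _)]powRD ?hk0 ?implybT // powRr1; last lra.
have -> : k + 1 = k * rho by rewrite /rho; field.
rewrite powRM; [|lra|by have := rho_ge1; lra].
by rewrite powRN -mulrA; congr (_ * _); rewrite mulKf // gt_eqF // powR_gt0; lra.
Qed.

Lemma powR_ge1 (x y : R) : 1 <= x -> 0 <= y -> 1 <= x `^ y.
Proof. by move=> hx hy; have := ler_powR hx hy; rewrite powRr0. Qed.

Lemma tau_ge1 : 1 <= tau d.
Proof.
have hk := k_ge1; have h1 := k_le; have h2 := k_gt.
by rewrite /tau -/k -[leLHS]mulr1 ler_pM // powR_ge1 //; lra.
Qed.

(** Weighted arithmetic-geometric mean inequality: d is the mean of k and k + 1 with weights k + 1 -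
    d and d - k. It is obtained from the tangent to ln at d ([hl]). *)
Lemma tau_le : tau d <= d.
Proof.
have hk := k_ge1; have h1 := k_le; have h2 := k_gt.
have ht : 0 < tau d by have := tau_ge1; lra.
have hd0 : 0 < d by lra.
rewrite -ler_ln ?posrE //.
rewrite /tau -/k lnM ?posrE ?powR_gt0 //; try lra.
rewrite !ln_powR.
have hl (x : R) : 0 < x -> ln x <= ln d + x / d - 1.
  move=> hx; have hxd : 0 < x / d by rewrite divr_gt0 //; lra.
  have hm : -1 < x / d - 1 by lra.
  by have := le_ln1Dx hm; rewrite addrCA subrr addr0 ln_div ?posrE //; lra.
have hA : ln k <= ln d + k / d - 1 by apply: hl; lra.
have hB : ln (k + 1) <= ln d + (k + 1) / d - 1 by apply: hl; lra.
apply: (@le_trans _ _ ((k + 1 - d) * (ln d + k / d - 1) + (d - k) * (ln d + (k + 1) / d - 1))).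
  by apply: lerD; apply: ler_wpM2l => //; lra.
rewrite le_eqVlt; apply/orP; left; apply/eqP.
by field; lra.
Qed.

(* Concavity of ln at the integers: m / rho ^ m is maximal at m = k. *)
Lemma nat_le_chord (m j : nat) : k = j%:R -> m%:R * rho ^+ j <= k * rho ^+ m.
Proof.
move=> hj; have hk := k_ge1; have hr := rho_ge1.
have up i : (j + i)%:R <= k * rho ^+ i.
  elim: i => [|i IH]; first by rewrite addn0 expr0 mulr1 hj.
  rewrite exprSr mulrA; apply: (@le_trans _ _ ((j + i)%:R * rho)); last first.
    by rewrite ler_wpM2r //; lra.
  rewrite addnS -natr1 natrD -hj /rho.
  rewrite -subr_ge0; have -> : (k + i%:R) * ((k + 1) / k) - (k + i%:R + 1) = i%:R / k.
    by field; lra.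
  by rewrite divr_ge0 //; lra.
have dn i : (i <= j)%N -> (j - i)%:R * rho ^+ i <= k.
  elim: i => [|i IH] hi; first by rewrite subn0 expr0 mulr1 hj.
  apply: le_trans (IH (ltnW hi)); rewrite exprS mulrA.
  rewrite ler_wpM2r ?exprn_ge0 //; first lra.
  rewrite /rho !natrB ?(ltnW hi) // -hj -natr1 mulrA ler_pdivrMr; last lra.
  by have : (0 : R) <= i%:R by []; nra.
case: (leqP j m) => h.
  rewrite -(subnKC h) exprD mulrCA [leLHS]mulrC ler_wpM2l ?exprn_ge0 ?up //; lra.
have := dn (j - m)%N (leq_subr _ _); rewrite subKn; last exact: ltnW.
move=> h1; rewrite -[in leLHS](subnKC (ltnW h)) exprD mulrCA mulrC ler_wpM2r ?exprn_ge0 //; lra.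
Qed.

(** Multiplying the chord bound over all [i] leaves only the sum, as an exponent of [rho]; since rho
    >= 1 it may be raised to d n. *)
Lemma prod_le_tau n (f : 'I_n -> nat) : (\sum_i f i)%:R <= d * n%:R ->
  (\prod_i f i)%:R <= tau d ^+ n.
Proof.
move=> hs; have [j hj0 hj] := floor_nat; have hk := k_ge1; have hr := rho_ge1.
have hr0 : 0 < rho by lra.
have h1 : (\prod_i f i)%:R * rho ^+ (j * n) <= k ^+ n * rho ^+ (\sum_i f i).
  rewrite natr_prod exprM -[n in _ * _ ^+ n]card_ord -prodr_const -big_split /=.
  have -> : k ^+ n = \prod_(i < n) k by rewrite prodr_const card_ord.
  rewrite expr_sum -big_split; apply: ler_prod => i _.
  by rewrite mulr_ge0 ?exprn_ge0 ?nat_le_chord //; lra.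
have h2 : rho ^+ (\sum_i f i) <= rho `^ (d * n%:R).
  by rewrite -powR_mulrn ?ler_powR //; lra.
have h3 : rho ^+ (j * n) * rho `^ ((d - k) * n%:R) = rho `^ (d * n%:R).
  rewrite -(powR_mulrn _ (ltW hr0)) -powRD; last by rewrite (gt_eqF hr0) implybT.
  by congr (_ `^ _); rewrite natrM -hj; ring.
rewrite tauE exprMn -[(_ `^ _) ^+ n]powR_mulrn ?powR_ge0 // -powRrM.
rewrite -(ler_pM2r (exprn_gt0 (j * n) hr0)); apply: (le_trans h1).
by rewrite -mulrA ler_wpM2l ?exprn_ge0 ?[_ * rho ^+ _]mulrC ?h3 //; lra.
Qed.

End Tau.

(** * Tours of the digraph *)

Lemma sum_next_at (T : eqType) (f : T -> T -> int) y0 y p : uniq (y :: p) ->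
  (\sum_(v <- y :: p) f v (next_at v y0 y p) = path_weight f y p + f (last y p) y0)%R.
Proof.
elim: p y => [|y' p IH] y; first by rewrite big_seq1 /= eqxx add0r.
rewrite cons_uniq => /andP[hy hu]; rewrite big_cons /= eqxx -addrA -(IH _ hu); congr +%R.
apply: eq_big_seq => v hv /=; case: eqP => // e; by rewrite -e hv in hy.
Qed.

(** [next] wraps around, so the closing edge can be put first, as a step from the last vertex into
    the list. *)
Lemma path_weight_next (T : eqType) (f : T -> T -> int) x0 (c : seq T) : uniq c ->
  (\sum_(v <- c) f v (next c v) = path_weight f (last x0 c) c)%R.
Proof.
case: c => [|y p] hu; first by rewrite big_nil.
by rewrite (sum_next_at _ _ hu) /= addrC.
Qed.

Section Tours.
Variables (n : nat) (e : rel 'I_n) (w : 'I_n -> 'I_n -> int).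
Hypothesis n_gt0 : 0 < n.

Definition vertex (u : nat) : 'I_n := insubd (Ordinal n_gt0) u.
Definition edge : rel nat := relpre vertex e.
(** Zero off the edges, so that [max_weight], a maximum over edges only, bounds it everywhere. *)
Definition edge_weight u v : int := if edge u v then w (vertex u) (vertex v) else 0%R.

Lemma vertexK (i : 'I_n) : vertex i = i.
Proof. exact: valKd. Qed.

Lemma val_vertex u : u < n -> vertex u = u :> nat.
Proof. by move=> h; rewrite val_insubd h. Qed.

Lemma path_weight_map u s : path edge u s ->
  path_weight w (vertex u) (map vertex s) = path_weight edge_weight u s.
Proof.
by elim: s u => [|v s IH] u //= /andP[h /IH ->]; rewrite /edge_weight h.
Qed.

Lemma tour_of_list s : perm_eq s (iota 0 n) -> path edge 0 s -> last 0 s = 0 ->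
  hamiltonian_cycle e (map vertex s) /\
  cycle_weight w (map vertex s) = path_weight edge_weight 0 s.
Proof.
move=> hs hp hl; have ms u : (u \in s) = (u < n) by rewrite (perm_mem hs) mem_iota.
have hlast : last (vertex 0) (map vertex s) = vertex 0 by rewrite last_map hl.
have hu : uniq (map vertex s).
  rewrite map_inj_in_uniq ?(perm_uniq hs) ?iota_uniq // => u v; rewrite !ms => hu hv.
  by move=> /(congr1 val); rewrite /= !val_vertex.
split; last by rewrite /cycle_weight (path_weight_next _ (vertex 0)) // hlast path_weight_map.
split; last by move=> v; rewrite -[v]vertexK map_f // ms.
by rewrite /ucycle hu andbT (cycle_path (vertex 0)) hlast path_map.
Qed.

Lemma list_of_tour c : hamiltonian_cycle e c ->
  exists s, [/\ perm_eq s (iota 0 n), path edge 0 s, last 0 s = 0 &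
    path_weight edge_weight 0 s = cycle_weight w c].
Proof.
move=> [/andP[hc hu] hall].
(* Rotate the cycle to begin at vertex 0 and then by one more place, so that vertex 0 comes last. *)
have [i p hip] := rot_to (hall (vertex 0)).
have hcr : rcons p (vertex 0) = rot 1 (rot i c) by rewrite hip rot1_cons.
have hcyc : cycle e (rcons p (vertex 0)) by rewrite hcr !rot_cycle.
have hur : uniq (rcons p (vertex 0)) by rewrite hcr !rot_uniq.
have hcw : cycle_weight w (rcons p (vertex 0)) = cycle_weight w c.
  rewrite /cycle_weight hcr; under eq_bigr => v _ do rewrite next_rot ?rot_uniq // next_rot //.
  by apply: perm_big; rewrite perm_rot perm_rot.
have hK : map vertex (map val (rcons p (vertex 0))) = rcons p (vertex 0).
  by rewrite -map_comp map_id_in // => v _; exact: vertexK.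
have hv0 : val (vertex 0) = 0 by exact: val_vertex.
have hp : path edge 0 (map val (rcons p (vertex 0))).
  have -> : forall u s, path edge u s = path e (vertex u) (map vertex s).
    by move=> u s; rewrite path_map.
  rewrite hK -{1}[vertex 0](last_rcons (vertex 0) p).
  by move: hcyc; rewrite (cycle_path (vertex 0)) last_rcons.
exists (map val (rcons p (vertex 0))); split=> //.
- apply: uniq_perm; rewrite ?iota_uniq ?(map_inj_uniq val_inj) // => u.
  rewrite mem_iota /=; apply/mapP/idP => [[v _ ->]|hlt]; first exact: ltn_ord.
  exists (Ordinal hlt) => //; rewrite hcr !mem_rot; exact: hall.
- by rewrite map_rcons last_rcons.
- rewrite -path_weight_map // hK -hcw /cycle_weight (path_weight_next _ (vertex 0)) //.
  by rewrite last_rcons.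
Qed.

(** * The layout of the input *)

Lemma nth_flatten_const (T : Type) (x0 : T) (ss : seq (seq T)) k i j :
  all (fun s => size s == k) ss -> i < size ss -> j < k ->
  nth x0 (flatten ss) (i * k + j) = nth x0 (nth [::] ss i) j.
Proof.
elim: ss i => // s ss IH [|i] /= /andP[/eqP hs hss] hi hj; rewrite nth_cat hs.
  by rewrite mul0n add0n hj.
rewrite mulSn -addnA ltnNge leq_addr /= addKn; exact: IH.
Qed.

Lemma size_flatten_const (T : Type) (ss : seq (seq T)) k :
  all (fun s => size s == k) ss -> size (flatten ss) = size ss * k.
Proof. by elim: ss => // s ss IH /= /andP[/eqP hs /IH hss]; rewrite size_cat hs hss mulSn. Qed.

Let cell i j : seq int := [:: Posz (nat_of_bool (e i j)); if e i j then w i j else 0%R].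

Lemma atsp_inputE : atsp_input e w =
  Posz n :: flatten (flatten [seq [seq cell i j | j <- enum 'I_n] | i <- enum 'I_n]).
Proof. by []. Qed.

Lemma input_cell (i j : 'I_n) f : f < 2 ->
  nth 0%R (atsp_input e w) (2 * (i * n + j) + f + 1) = nth 0%R (cell i j) f.
Proof.
move=> hf; rewrite atsp_inputE addn1 /= [2 * _]mulnC.
have sr (i' : 'I_n) : size [seq cell i' j | j <- enum 'I_n] = n by rewrite size_map size_enum_ord.
have h1 : all (fun s => size s == n) [seq [seq cell i j | j <- enum 'I_n] | i <- enum 'I_n].
  by apply/allP => s /mapP[i' _ ->]; rewrite sr.
have h2 : all (fun s => size s == 2) (flatten [seq [seq cell i j | j <- enum 'I_n] | i <- enum 'I_n]).
  by apply/allP => s /flattenP[s' /mapP[i' _ ->] /mapP[j' _ ->]].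
have hij : i * n + j < n * n by have := ltn_ord i; have := ltn_ord j; nia.
have hsz : i * n + j < size (flatten [seq [seq cell i j | j <- enum 'I_n] | i <- enum 'I_n]).
  by rewrite (size_flatten_const h1) size_map size_enum_ord.
have hi : i < size (enum 'I_n) by rewrite size_enum_ord.
have hj : j < size (enum 'I_n) by rewrite size_enum_ord.
have him : i < size [seq [seq cell i j | j <- enum 'I_n] | i <- enum 'I_n] by rewrite size_map.
rewrite (nth_flatten_const _ h2 hsz hf) (nth_flatten_const _ h1 him (ltn_ord j)).
by rewrite (nth_map i _ _ hi) nth_ord_enum (nth_map j _ _ hj) nth_ord_enum.
Qed.

Lemma input_init : input n edge edge_weight (nth 0%R (atsp_input e w)).
Proof.
move=> u v hu hv; have := input_cell (vertex u) (vertex v).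
rewrite !val_vertex // => h; split; first by have := h 0 isT; rewrite addn0.
move=> he; have he' : e (vertex u) (vertex v) by [].
by have := h 1 isT; rewrite -addnA /= /edge_weight he he'.
Qed.

Lemma input_fresh : fresh (nth 0%R (atsp_input e w)) (n * n * 2 + 1).
Proof.
have hsz : size (atsp_input e w) = (n * n * 2 + 1)%N.
  rewrite atsp_inputE addn1 /=; congr S; rewrite (@size_flatten_const _ _ 2).
    rewrite (@size_flatten_const _ _ n); first by rewrite size_map size_enum_ord.
    by apply/allP => s /mapP[i' _ ->]; rewrite size_map size_enum_ord.
  by apply/allP => s /flattenP[s' /mapP[i' _ ->] /mapP[j' _ ->]].
by move=> x hx; rewrite nth_default // hsz.
Qed.

Lemma edge_weight_le u v : absz (edge_weight u v) <= max_weight e w.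
Proof.
rewrite /edge_weight; case: ifP => // h; rewrite /max_weight.
exact: (@leq_bigmax_cond _ (fun p => e p.1 p.2) (fun p => absz (w p.1 p.2)) (vertex u, vertex v)).
Qed.

Lemma sum_deg : \sum_(u < n) deg_upto edge n u = #|[set p : 'I_n * 'I_n | e p.1 p.2]|.
Proof.
rewrite -sum1_card; under eq_bigl do rewrite inE.
rewrite -(pair_big_dep xpredT (fun i j => e i j) (fun _ _ => 1)) /=.
apply: eq_bigr => u _; rewrite /deg_upto [RHS]big_mkcond.
by apply: eq_bigr => v _; rewrite /edge /= !vertexK; case: (e u v).
Qed.

Lemma atsp_answer m l s : regs s = nth 0%R l -> cells s = m ->
  optimal_answer n edge edge_weight l m -> atsp_output e w s.
Proof.
move=> hl hm [[h0 h]|[h0 [x1 [x2 [g1 g2 hx hmin hout]]]]]; [left|right].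
  rewrite hl; split=> // c /list_of_tour[s' [h1 h2 h3 _]].
  have [x1 [x2 [g1 g2 h4 _]]] := tour_matching edge_weight n_gt0 h1 h2 h3.
  by have := h _ _ g1 g2; rewrite h4.
rewrite hl; split=> //.
have [h1 h2 h3 h4] := matching_tour edge_weight g1 g2 hx.
set s0 := rev _ in h1 h2 h3 h4 hout.
have [hc hw] := tour_of_list h1 h2 h3.
exists (map vertex s0).
  split=> // c' /list_of_tour[s' [h1' h2' h3' <-]].
  have [x1' [x2' [g1' g2' h4' <-]]] := tour_matching edge_weight n_gt0 h1' h2' h3'.
  by rewrite hw h4; exact: hmin.
rewrite hm hout -map_comp; apply/eq_in_map => u hu /=.
by rewrite val_vertex //; move: hu; rewrite (perm_mem h1) mem_iota.
Qed.

End Tours.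

(** * Resource bounds *)

Lemma compile_ghost n N : compile 0 (atsp_cmd n N) = compile 0 (atsp_cmd 0 0).
Proof. by rewrite -compile_erase -[RHS]compile_erase. Qed.

Definition records_bound n r := n * n.+1 * r.
Definition memory_bound n r :=
  n * n * 2 + 1 + 6 * records_bound n r + 2 * n + 4 * (n * records_bound n r) + 2.

Lemma records_bound_le n r : 0 < n -> n * records_bound n r <= 2 * n ^ 3 * r.
Proof.
move=> n0; rewrite /records_bound !mulnA leq_mul2r; apply/orP; right.
by nia.
Qed.

Lemma records_bound_ge n r : 0 < n -> 0 < r ->
  let N := records_bound n r in [/\ 0 < n * N, n <= n * N, N <= n * N & n * n <= n * N].
Proof.
move=> n0 r0 N; have hN : n <= N by rewrite /N /records_bound -mulnA leq_pmulr ?muln_gt0.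
have N0 : 0 < N by exact: leq_trans hN.
by split; rewrite ?muln_gt0 ?n0 ?leq_pmulr ?leq_pmull ?leq_mul2l ?hN ?orbT.
Qed.

(** Each of the [N] walks causes a bounded number of loops over [n] vertices or bits, and reading
    the input takes order n^2 steps, with n^2 <= n * N. The constant is generous. *)
Lemma cost_le n r : 0 < n -> 0 < r ->
  cost (atsp_cmd n (records_bound n r)) <= 1000 * (n * records_bound n r).
Proof.
move=> n0 r0; have := records_bound_ge n0 r0; move: (records_bound n r) => N /= [h1 h2 h3 h4].
have e : n * (N * n) = n * n * N by lia.
by rewrite /cost /=; lia.
Qed.

Lemma memory_le n r : 0 < n -> 0 < r ->
  memory_bound n r <= 17 * (n * records_bound n r).
Proof.
move=> n0 r0; rewrite /memory_bound; have := records_bound_ge n0 r0.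
by move: (records_bound n r) => N /= [h1 h2 h3 h4]; lia.
Qed.

(** By m <= 2^m in each factor. As the number of edges is linear in n, degree products have O(n)
    bits. *)
Lemma prod_deg_le n (E : rel nat) j : j <= n ->
  \prod_(v < j) deg_upto E n v <= 2 ^ (\sum_(v < n) deg_upto E n v).
Proof.
move=> hj; apply: (@leq_trans (2 ^ (\sum_(v < j) deg_upto E n v))).
  rewrite expn_sum; apply: leq_prod => v _; exact/ltnW/ltn_expl.
rewrite leq_exp2l // -!(big_mkord xpredT (deg_upto E n)) (@big_cat_nat _ _ _ j 0 n) //=.
exact: leq_addr.
Qed.

Section Bounds.
Variables (n D r W Lw : nat) (E : rel nat).
Hypothesis n0 : 0 < n.
Hypothesis r0 : 0 < r.
Hypothesis hr : r <= 2 * n * D ^ n.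
Hypothesis hE : \sum_(v < n) deg_upto E n v <= D * n.
Hypothesis hW : W < 2 ^ Lw.
(** The term 2 D comes from squaring a degree product in [square_lt]; 20 absorbs the polynomial
    factors. *)
Let b := (2 * D + 20) * (n + Lw).

Lemma r_le : r <= 2 ^ ((D + 2) * n).
Proof.
apply: (leq_trans hr); rewrite mulnDl expnD mulnC; apply: leq_mul.
  by rewrite expnM leq_exp2r //; exact/ltnW/ltn_expl.
exact/ltnW/ltn_expl.
Qed.

Lemma memory_lt : memory_bound n r + 12 < 2 ^ b.
Proof.
have h1 := memory_le n0 r0; have h2 := records_bound_le r n0.
have h3 : n ^ 3 <= 2 ^ (3 * n) by rewrite mulnC expnM leq_exp2r //; exact/ltnW/ltn_expl.
have h4 := leq_mul h3 r_le; rewrite -expnD in h4.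
have h5 : 1 <= n ^ 3 * r by rewrite muln_gt0 expn_gt0 n0.
(* The memory is at most 17 * 2 = 34 times n^3 r, and with 12 more it stays below 64 = 2^6 times
   that. *)
apply: (@leq_trans (64 * 2 ^ (3 * n + (D + 2) * n))).
  by rewrite -[2 * n ^ 3 * r]mulnA in h2; lia.
rewrite -[64]/(2 ^ 6) -expnD leq_exp2l // /b; nia.
Qed.

Lemma pow_lt : 2 ^ n.+1 < 2 ^ b.
Proof. by rewrite ltn_exp2l // /b; nia. Qed.

Lemma square_lt : (n * r) * (n * r) < 2 ^ b.
Proof.
have h : n * r <= 2 ^ (n + (D + 2) * n) by rewrite expnD leq_mul ?r_le //; exact/ltnW/ltn_expl.
apply: leq_ltn_trans (leq_mul h h) _; rewrite -expnD ltn_exp2l // /b; nia.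
Qed.

Lemma threshold_lt j : j <= n -> deg_threshold n E j < 2 ^ b.
Proof.
move=> hj; have h1 := prod_deg_le E hj.
have h2 : 2 ^ (\sum_(v < n) deg_upto E n v) <= 2 ^ (D * n) by rewrite leq_exp2l.
have h3 : n * n * 2 <= 2 ^ (n + n + 1).
  by rewrite !expnD leq_mul // leq_mul //; exact/ltnW/ltn_expl.
rewrite /deg_threshold; apply: leq_ltn_trans (leq_mul h3 (leq_trans h1 h2)) _.
by rewrite -expnD ltn_exp2l // /b; nia.
Qed.

Lemma weights_lt : 2 * (n * W) < 2 ^ b.
Proof.
have h : n * W <= 2 ^ (n + Lw) by rewrite expnD leq_mul //; [exact/ltnW/ltn_expl|exact: ltnW].
apply: (@leq_ltn_trans (2 ^ (n + Lw).+1)); first by rewrite expnS leq_mul2l.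
by rewrite ltn_exp2l // /b; nia.
Qed.

End Bounds.

Section Reals.
Local Open Scope ring_scope.
Variables (R : realType) (d : R).
Hypothesis hd : 1 <= d.

Let t (n : nat) : R := tau d `^ (n%:R / 2%:R).
(** The square root of the bound 2 n^2 tau(d)^n on the threshold, with the root of 2 rounded up to
    2. *)
Definition walk_bound (n : nat) : nat := Num.trunc (2 * n%:R * t n).

Lemma t_ge1 n : 1 <= t n.
Proof. by rewrite powR_ge1 ?tau_ge1 // divr_ge0. Qed.

Lemma t_sqr n : t n * t n = tau d ^+ n.
Proof.
have h := tau_ge1 hd; have h0 : tau d != 0 by apply: lt0r_neq0; lra.
rewrite /t -powRD ?h0 ?implybT // -splitr powR_mulrn //; lra.
Qed.

Lemma walk_bound_le n : (walk_bound n)%:R <= 2 * n%:R * t n.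
Proof. by rewrite truncn_le; have := t_ge1 n; have : (0:R) <= n%:R by []; nra. Qed.

Lemma walk_bound_gt0 n : (0 < n)%N -> (0 < walk_bound n)%N.
Proof.
move=> hn; rewrite truncn_gt0; have : (1:R) <= n%:R by rewrite ler1n.
by have := t_ge1 n; nra.
Qed.

Lemma walk_bound_ge n q : (q%:R * q%:R : R) <= 2 * n%:R * n%:R * tau d ^+ n ->
  (q <= walk_bound n)%N.
Proof.
have ht := t_ge1 n; have hn : (0:R) <= n%:R by [].
have h0 : 0 <= 2 * n%:R * t n by nra.
rewrite truncn_ge_nat // -t_sqr => h.
rewrite -(@ler_pXn2r _ 2) ?nnegrE // !expr2; apply: (le_trans h).
have : 0 <= (n%:R * t n) * (n%:R * t n) by apply: sqr_ge0.
lra.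
Qed.

(** Replacing tau(d)^(n/2) by an integer power is wasteful, but only the constant in the word length
    depends on it. *)
Lemma walk_bound_nat n : (walk_bound n <= 2 * n * (Num.trunc d).+1 ^ n)%N.
Proof.
rewrite -(ler_nat R) !natrM natrX; apply: (le_trans (walk_bound_le n)).
have hD : d <= (Num.trunc d).+1%:R by exact/ltW/truncnS_gt.
rewrite ler_wpM2l // -powR_mulrn //; apply: (@le_trans _ _ ((Num.trunc d).+1%:R `^ (n%:R / 2%:R))).
  have := tau_ge1 hd; have := tau_le hd => h1 h2.
  by rewrite ge0_ler_powR ?nnegrE ?divr_ge0 //; lra.
apply: ler_powR; first by rewrite ler1n.
by have : (0:R) <= n%:R by []; lra.
Qed.

Lemma Ostar_records (f : nat -> nat) c :
  (forall n, (0 < n)%N -> (f n <= c * (n * records_bound n (walk_bound n)))%N) -> Ostar t f.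
Proof.
(* The records contribute 2 n^3 and the walk bound 2 n, which makes 4 c and n^4. *)
move=> hf; exists (4 * c)%N, 4%N => n hn.
have h1 : (f n <= c * (2 * n ^ 3 * walk_bound n))%N.
  by apply: leq_trans (hf n hn) _; rewrite leq_mul2l records_bound_le ?orbT.
apply: (@le_trans _ _ (c%:R * (2 * n%:R ^+ 3 * (2 * n%:R * t n)))).
  have : (f n)%:R <= (c * (2 * n ^ 3 * walk_bound n))%:R :> R by rewrite ler_nat.
  move=> /le_trans -> //.
  have -> : (c * (2 * n ^ 3 * walk_bound n))%:R = c%:R * (2 * n%:R ^+ 3 * (walk_bound n)%:R) :> R.
    by rewrite -natrX -!natrM.
  by rewrite !ler_wpM2l ?mulr_ge0 ?exprn_ge0 // walk_bound_le.
by rewrite natrM le_eqVlt; apply/orP; left; apply/eqP; ring.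
Qed.

End Reals.

Local Open Scope ring_scope.

Theorem theorem2 (R : realType) (d : R) (hd : 1 <= d) :
  tau d <= d /\
  atsp_solvable (fun (n : nat) (e : rel 'I_n) => avg_outdeg R e <= d)
    (fun n : nat => tau d `^ (n%:R / 2%:R))
    (fun n : nat => tau d `^ (n%:R / 2%:R)).
Proof.
split; first exact: tau_le.
(* [D] is an integer above [d], needed since the word length constant is a natural number. *)
pose D := (Num.trunc d).+1; pose r n := walk_bound d n.
exists (compile 0 (atsp_cmd 0 0)), (2 * D + 20)%N,
  (fun n => cost (atsp_cmd n (records_bound n (r n)))), (fun n => memory_bound n (r n)); split.
- by apply: Ostar_records => // n hn; apply: cost_le => //; exact: walk_bound_gt0.
- by apply: Ostar_records => // n hn; apply: memory_le => //; exact: walk_bound_gt0.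
move=> n e w hn he; pose E := edge e hn.
have n1 : (1 : R) <= n%:R by rewrite ler1n.
have hsum : (\sum_(u < n) deg_upto E n u)%:R <= d * n%:R.
  by move: he; rewrite /avg_outdeg ler_pdivrMr ?sum_deg //; lra.
have hsumD : (\sum_(u < n) deg_upto E n u <= D * n)%N.
  rewrite -(ler_nat R) natrM; apply: (le_trans hsum); rewrite ler_wpM2r //.
  exact/ltW/truncnS_gt.
have hr0 := walk_bound_gt0 hd hn.
have hrD : (r n <= 2 * n * D ^ n)%N by exact: walk_bound_nat.
(* The only place where the average outdegree controls the number of walks: it bounds the product of
   all outdegrees by tau(d)^n. *)
have hr q : (q * q < deg_threshold n E n)%N -> (q <= r n)%N.
  move=> /ltnW; rewrite -(ler_nat R) natrM /deg_threshold => hq.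
  apply: walk_bound_ge => //; apply: (le_trans hq); rewrite !natrM.
  have := prod_le_tau hd hsum; set p := (\prod_(_ < n) _)%:R => hp.
  have : 0 <= n%:R * n%:R * (tau d ^+ n - p) by apply: mulr_ge0; nra.
  by lra.
have hW : (max_weight e w < 2 ^ up_log 2 (max_weight e w).+1)%N by exact: up_logP.
have hwp : wpre (memory_bound n (r n)) (word_length (2 * D + 20) e w)
    (atsp_cmd n (records_bound n (r n))) (optimal_answer n E (edge_weight e w hn))
    (nseq 27 0) (nth 0 (atsp_input e w)).
  eapply wp_atsp.
  - exact: hn.
  - exact: hr0.
  - exact: hr.
  - exact: leqnn.
  - exact: (memory_lt hn hr0 hrD hsumD hW).
  - exact: (pow_lt hn hr0 hrD hsumD hW).
  - exact: (square_lt hn hr0 hrD hsumD hW).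
  - exact: (threshold_lt hn hr0 hrD hsumD hW).
  - exact: edge_weight_le.
  - exact: (weights_lt hn hr0 hrD hsumD hW).
  - by [].
  - exact: input_init.
  - exact: input_fresh.
have [s hs [l [hl hm]]] := wp_run hwp (leqnn _).
rewrite compile_ghost in hs; exists s; first by rewrite /init_state hs.
exact: atsp_answer hl erefl hm.
Qed.
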